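(* Let $\mathrm{Sk}(v)$ be an admissible component. The map $u\mapsto\sigma_b^u$ induces a group monomorphism $\mathrm{Sk}^D(v)\to GL(V_b)$. For $u\in\mathrm{Sp}^D(v)$ the map $\sigma_b^u$ preserves $\Sigma_{\mathrm{pr}}$, and $u\mapsto\sigma_b^u|_{\Sigma_{\mathrm{pr}}}$ is a group homomorphism from $\mathrm{Sp}^D(v)$ whose image lies in the group of automorphisms of the Dynkin diagram of $\Sigma_{\mathrm{pr}}$, i.e. in $$\operatorname{Dynkin}(\Sigma_{\mathrm{pr}}):=\{\psi\in\operatorname{Aut}(\Sigma_{\mathrm{pr}})\mid p(\psi(\alpha))=p(\alpha),\ \langle\alpha^\vee,\beta\rangle=\langle\psi(\alpha)^\vee,\psi(\beta)\rangle\ \text{for all }\alpha,\beta\in\Sigma_{\mathrm{pr}}\},$$ where $\operatorname{Aut}(\Sigma_{\mathrm{pr}})$ is the group of bijections of the set $\Sigma_{\mathrm{pr}}$.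
   Context: All vector spaces are over $\mathbb C$. Fix a finite set $X$. A root datum is $v=(\mathfrak h,a,b,p)$ with $\mathfrak h$ a finite-dimensional vector space, $a:X\to\mathfrak h$ and $b:X\to\mathfrak h^*$ maps whose values form linearly independent families, and $p:X\to\mathbb Z_2$. Write $a_v,b_v,p_v$ for these maps. The Cartan matrix is $A^v=(a^v_{xy})$, $a^v_{xy}=\langle a_v(x),b_v(y)\rangle$; the pair $(A^v,p_v)$ is the Cartan datum at $v$. An element $x\in X$ is reflectable at $v$ if either $a_{xx}=0$, $p(x)=\bar1$; or $a_{xx}\ne0$, $p(x)=\bar0$ and $2a_{xy}/a_{xx}\in\mathbb Z_{\le0}$ for all $y\ne x$; or $a_{xx}\ne0$, $p(x)=\bar1$ and $a_{xy}/a_{xx}\in\mathbb Z_{\le0}$ for all $y\ne x$. For such $x$ the reflexion $r_x:v\to v'=(\mathfrak h,a',b',p')$ is: if $a_{xx}\neq0$ (anisotropic reflexion), $p'=p$, $a'(y)=a(y)-2\frac{a_{yx}}{a_{xx}}a(x)$, $b'(y)=b(y)-2\frac{a_{xy}}{a_{xx}}b(x)$; if $a_{xx}=0$ (isotropic reflexion), $(a',b',p')(x)=(-a(x),-b(x),p(x))$, and for $y\ne x$: $(a',b',p')(y)=(a(y),b(y),p(y))$ if $a_{xy}=0$, $(a',b',p')(y)=(a(y)+\frac{a_{yx}}{a_{xy}}a(x),\,b(y)+b(x),\,p(y)+\bar1)$ if $a_{xy}\ne0$. The skeleton $\mathrm{Sk}(v)$ (resp. the spine $\mathrm{Sp}(v)$)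 is the set of root data obtained from $v$ by finite sequences of reflexions (resp. isotropic reflexions), viewed as a graph with edges $u\leftrightarrow r_x(u)$ marked by $r_x$. The component is admissible if $a^u_{xy}=0\Rightarrow a^u_{yx}=0$ for all $u\in\mathrm{Sk}(v)$, all $x$ reflectable at $u$ and all $y\in X$. $V_b\subset\mathfrak h^*$ is the span of $\{b_v(x)\}_{x\in X}$ (the same for all $u\in\mathrm{Sk}(v)$). The parity $p$ extends to a homomorphism $p:\mathbb Z\{b_v(x)\}_{x\in X}\to\mathbb Z_2$, $b_u(x)\mapsto p_u(x)$ for all $u\in \mathrm{Sk}(v)$. For $u\in\mathrm{Sk}(v)$ define $\sigma_b^u\in GL(V_b)$ by $\sigma_b^u(b_v(x))=b_u(x)$, $x\in X$. Two Cartan data $(A,p),(A',p')$ are $D$-equivalent if $p=p'$ and $A=DA'$ for an invertible diagonal matrix $D$. $\mathrm{Sk}^D(v)$ is the set of $u\in\mathrm{Sk}(v)$ whose Cartan datum is $D$-equivalent to that of $v$; $\mathrm{Sp}^D(v)=\mathrm{Sk}^D(v)\cap\mathrm{Sp}(v)$. For $v'\in\mathrm{Sk}^D(v)$ and $u\in\mathrm{Sk}(v)$ choose a path from $v$ to $u$; there is a unique path starting at $v'$ with the same sequence of marks, and its endpoint $\sigma^{v'}(u)$ does not depend on the chosen path. The group operation on $\mathrm{Sk}^D(v)$ is $u_1*u_2:=\sigma^{u_1}(u_2)$, with unit $v$; $\mathrm{Sp}^D(v)$ is a subgroup. $\Sigma_{\mathrm{pr}}$ (principal roots) is the set of $b_u(x)$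 with $u\in\mathrm{Sp}(v)$, $x$ reflectable at $u$ and $a^u_{xx}\ne0$; for $\alpha=b_u(x)\in\Sigma_{\mathrm{pr}}$ put $\alpha^\vee:=\frac{2}{a^u_{xx}}a_u(x)$ (independent of choices). *)

(* Defs.v *)
From HB Require Import structures.
From mathcomp Require Import all_boot all_order all_algebra.
From mathcomp Require Import boolp classical_sets reals.
From mathcomp Require Import complex.
From mathcomp Require Import ring.

Set Implicit Arguments.
Unset Strict Implicit.
Unset Printing Implicit Defensive.

Import Order.TTheory GRing.Theory Num.Theory.
Local Open Scope ring_scope.

Notation dual h := 'Hom(h, (GRing.regular _)).

Section LinearExtension.
Variables (K : fieldType) (X : finType) (V W : vectType K).
Implicit Types (f : {ffun X -> V}) (g : X -> W).

Definition fcoord f (x : X) (w : V) : K := coord (codom_tuple f) (enum_rank x) w.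

(* The linear map sending f x to g x, when the family f is free. *)
Definition lin_ext f g (w : V) : W := \sum_x fcoord f x w *: g x.

Fact lin_ext_is_linear f g : linear (lin_ext f g).
Proof.
move=> c u w; rewrite /lin_ext scaler_sumr -big_split; apply: eq_bigr => x _ /=.
by rewrite /fcoord linearP scalerDl scalerA.
Qed.
HB.instance Definition _ f g :=
  GRing.isLinear.Build K V W *:%R (lin_ext f g) (lin_ext_is_linear f g).

Lemma nth_codom f x : (codom_tuple f)`_(enum_rank x) = f x.
Proof. by rewrite /= (nth_map x) ?nth_enum_rank // -cardE. Qed.

Lemma fcoord_free f x y : free (codom f) -> fcoord f x (f y) = (y == x)%:R.
Proof.
move=> fF; rewrite /fcoord -{1}(nth_codom f y).
rewrite (@coord_free _ _ _ (codom_tuple f) (enum_rank y)) //.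
by rewrite (inj_eq enum_rank_inj).
Qed.

Lemma lin_extE f g x : free (codom f) -> lin_ext f g (f x) = g x.
Proof.
move=> fF; rewrite /lin_ext (bigD1 x) //= fcoord_free // eqxx scale1r.
rewrite big1 ?addr0 // => y nyx; rewrite fcoord_free // eq_sym.
by rewrite (negbTE nyx) scale0r.
Qed.

Lemma fcoord_span f w : w \in <<codom f>>%VS -> w = \sum_x fcoord f x w *: f x.
Proof.
move=> wf; rewrite {1}(@coord_span _ _ _ (codom_tuple f) w) //.
rewrite (reindex (@enum_rank X)) /=; last by apply: onW_bij; exact: enum_rank_bij.
by apply: eq_bigr => x _; rewrite nth_codom.
Qed.

End LinearExtension.

Section Shear.
Variables (K : fieldType) (X : finType) (V : vectType K).
Implicit Types (f g : {ffun X -> V}).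

Lemma codom_span f y : f y \in <<codom f>>%VS.
Proof. by apply: memv_span; exact: codom_f. Qed.

Lemma shear_span f g x : g x = - f x ->
  (forall y, y != x -> exists c, g y = f y + c *: f x) ->
  <<codom g>>%VS = <<codom f>>%VS.
Proof.
move=> gx gy; have gxf y : exists c, g y = (if y == x then - 1 else 1) *: f y + c *: f x.
  case: eqVneq => [->|/gy[c ->]]; last by exists c; rewrite scale1r.
  by exists 0; rewrite scale0r addr0 scaleN1r.
apply/eqP; rewrite eqEsubv; apply/andP; split; apply/span_subvP => _ /codomP[y ->].
  by case: (gxf y) => c ->; rewrite rpredD // rpredZ // codom_span.
have fx : f x \in <<codom g>>%VS by rewrite -(opprK (f x)) -gx rpredN codom_span.
have [->//|/gy[c e]] := eqVneq y x.
by rewrite -(addrK (c *: f x) (f y)) -e rpredB ?rpredZ ?codom_span.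
Qed.

Lemma shear_free f g x : g x = - f x ->
  (forall y, y != x -> exists c, g y = f y + c *: f x) ->
  free (codom f) -> free (codom g).
Proof.
by move=> gx gy; rewrite /free (shear_span gx gy) !size_codom.
Qed.

End Shear.

Section RootDatum.
Variables (K : numFieldType) (X : finType) (h : vectType K).

Record rootDatum := RootDatum {
  rd_a : {ffun X -> h};
  rd_b : {ffun X -> dual h};
  rd_p : {ffun X -> 'Z_2};
  rd_a_free : free (codom rd_a);
  rd_b_free : free (codom rd_b) }.

HB.instance Definition _ := gen_eqMixin rootDatum.
HB.instance Definition _ := gen_choiceMixin rootDatum.

Lemma rootDatum_eq u w :
  rd_a u = rd_a w -> rd_b u = rd_b w -> rd_p u = rd_p w -> u = w.
Proof.
case: u w => [a b p fa fb] [a' b' p' fa' fb'] /= ea eb ep.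
subst a' b' p'; congr RootDatum; exact: bool_irrelevance.
Qed.

Definition cartan (u : rootDatum) (x y : X) : K := rd_b u y (rd_a u x).

Definition nonpos_int (c : K) : Prop := exists n : nat, c = - n%:R.

Definition reflectable (u : rootDatum) (x : X) : Prop :=
  [\/ cartan u x x = 0 /\ rd_p u x = 1,
      [/\ cartan u x x != 0, rd_p u x = 0 &
          forall y, y != x -> nonpos_int (2 * cartan u x y / cartan u x x)] |
      [/\ cartan u x x != 0, rd_p u x = 1 &
          forall y, y != x -> nonpos_int (cartan u x y / cartan u x x)]].

Section Reflexion.
Variables (u : rootDatum) (x : X).
Let A := cartan u.

Definition reflexion_a : {ffun X -> h} := [ffun y =>
  if A x x != 0 then rd_a u y - (2 * A y x / A x x) *: rd_a u x
  else if y == x then - rd_a u x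
  else if A x y == 0 then rd_a u y
  else rd_a u y + (A y x / A x y) *: rd_a u x].

Definition reflexion_b : {ffun X -> dual h} := [ffun y =>
  if A x x != 0 then rd_b u y - (2 * A x y / A x x) *: rd_b u x
  else if y == x then - rd_b u x
  else if A x y == 0 then rd_b u y
  else rd_b u y + rd_b u x].

Definition reflexion_p : {ffun X -> 'Z_2} := [ffun y =>
  if A x x != 0 then rd_p u y
  else if y == x then rd_p u x
  else if A x y == 0 then rd_p u y
  else rd_p u y + 1].

Lemma reflexion_a_x : reflexion_a x = - rd_a u x.
Proof.
rewrite ffunE eqxx; case: ifP => // Ax.
by rewrite mulfK // -{1}[rd_a u x]scale1r -scalerBl -scaleN1r; congr (_ *: _); ring.
Qed.

Lemma reflexion_b_x : reflexion_b x = - rd_b u x.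
Proof.
rewrite ffunE eqxx; case: ifP => // Ax.
by rewrite mulfK // -{1}[rd_b u x]scale1r -scalerBl -scaleN1r; congr (_ *: _); ring.
Qed.

Lemma reflexion_a_y y : y != x ->
  exists c, reflexion_a y = rd_a u y + c *: rd_a u x.
Proof.
move=> nyx; rewrite ffunE (negbTE nyx); case: ifP => _.
  by exists (- (2 * A y x / A x x)); rewrite scaleNr.
by case: ifP => _; [exists 0; rewrite scale0r addr0 | exists (A y x / A x y)].
Qed.

Lemma reflexion_b_y y : y != x ->
  exists c, reflexion_b y = rd_b u y + c *: rd_b u x.
Proof.
move=> nyx; rewrite ffunE (negbTE nyx); case: ifP => _.
  by exists (- (2 * A x y / A x x)); rewrite scaleNr.
by case: ifP => _; [exists 0; rewrite scale0r addr0 | exists 1; rewrite scale1r].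
Qed.

(* This is total: the formulas yield free families for every x, reflectable
   or not. Reflectability is imposed by is_walk below. *)
Definition reflexion : rootDatum :=
  @RootDatum reflexion_a reflexion_b reflexion_p
    (shear_free reflexion_a_x reflexion_a_y (rd_a_free u))
    (shear_free reflexion_b_x reflexion_b_y (rd_b_free u)).

End Reflexion.

Fixpoint walk (u : rootDatum) (s : seq X) : rootDatum :=
  if s is x :: s' then walk (reflexion u x) s' else u.

Fixpoint is_walk (u : rootDatum) (s : seq X) : Prop :=
  if s is x :: s' then reflectable u x /\ is_walk (reflexion u x) s' else True.

Fixpoint is_iso_walk (u : rootDatum) (s : seq X) : Prop :=
  if s is x :: s' then
    [/\ reflectable u x, cartan u x x = 0 & is_iso_walk (reflexion u x) s']
  else True.

Definition Sk_set (v : rootDatum) : set rootDatum :=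
  [set u | exists2 s, is_walk v s & walk v s = u].

Definition Sp_set (v : rootDatum) : set rootDatum :=
  [set u | exists2 s, is_iso_walk v s & walk v s = u].

Definition admissible (v : rootDatum) : Prop :=
  forall u, Sk_set v u -> forall x, reflectable u x ->
  forall y, cartan u x y = 0 -> cartan u y x = 0.

Definition D_equiv (u w : rootDatum) : Prop :=
  rd_p u = rd_p w /\
  exists d : X -> K, (forall x, d x != 0) /\
    forall x y, cartan u x y = d x * cartan w x y.

(* [translate v v' u] is the endpoint of the path from v' that has the same
   marks as a chosen path from v to u. When v' is D-equivalent to v, that path
   exists and its endpoint does not depend on the choice: see
   [is_walk_translate] and [walk_indep]. *)
Definition chosen_walk (v u : rootDatum) : seq X :=
  xget [::] [set s | is_walk v s /\ walk v s = u].

Definition translate (v v' u : rootDatum) : rootDatum :=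
  walk v' (chosen_walk v u).

Definition ca u (x y : X) : K :=
  if (cartan u x x == 0) && (y == x) then - 1 else 1.
Definition da u (x y : X) : K :=
  if cartan u x x != 0 then - (2 * cartan u y x / cartan u x x)
  else if y == x then 0
  else if cartan u x y == 0 then 0 else cartan u y x / cartan u x y.
Definition db u (x y : X) : K :=
  if cartan u x x != 0 then - (2 * cartan u x y / cartan u x x)
  else if y == x then 0
  else if cartan u x y == 0 then 0 else 1.

Lemma reflexion_aE u x y :
  rd_a (reflexion u x) y = ca u x y *: rd_a u y + da u x y *: rd_a u x.
Proof.
rewrite ffunE /ca /da.
case: (eqVneq (cartan u x x) 0) => _ /=; last by rewrite scale1r scaleNr.
case: (eqVneq y x) => [->|_] /=; first by rewrite scaleN1r scale0r addr0.
by case: ifP => _; rewrite !scale1r ?scale0r ?addr0.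
Qed.

Lemma reflexion_bE u x y :
  rd_b (reflexion u x) y = ca u x y *: rd_b u y + db u x y *: rd_b u x.
Proof.
rewrite ffunE /ca /db.
case: (eqVneq (cartan u x x) 0) => _ /=; last by rewrite scale1r scaleNr.
case: (eqVneq y x) => [->|_] /=; first by rewrite scaleN1r scale0r addr0.
by case: ifP => _; rewrite !scale1r ?scale0r ?addr0.
Qed.

Lemma lform_l (f g : dual h) c d s : (c *: f + d *: g) s = c * f s + d * g s :> K.
Proof. by rewrite add_lfunE !scale_lfunE. Qed.

Lemma lform_r (f : dual h) c d s t : f (c *: s + d *: t) = c * f s + d * f t :> K.
Proof. by rewrite linearD !linearZ. Qed.

Lemma reflexion_cartan u x y z : cartan (reflexion u x) y z =
  ca u x z * (ca u x y * cartan u y z + da u x y * cartan u x z) +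
  db u x z * (ca u x y * cartan u y x + da u x y * cartan u x x).
Proof.
rewrite /cartan reflexion_aE reflexion_bE.
by rewrite lform_l !lform_r.
Qed.

Lemma reflexion_cartan_x u x z : cartan (reflexion u x) x z =
  (if cartan u x x == 0 then - cartan u x z else cartan u x z).
Proof.
rewrite reflexion_cartan /ca /da /db eqxx.
have [E|N] := eqVneq (cartan u x x) 0; last by rewrite /=; field.
by rewrite E /=; have [->|_] := eqVneq z x; rewrite /= ?E; ring.
Qed.

Lemma reflexion_cartan_xr u x y : cartan u x x = 0 -> y != x ->
  cartan (reflexion u x) y x = - cartan u y x.
Proof.
by move=> E nyx; rewrite reflexion_cartan /ca /da /db E !eqxx (negbTE nyx) /=; ring.
Qed.

Lemma reflexion_cartan_an u x y z : cartan u x x != 0 ->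
  cartan (reflexion u x) y z = cartan u y z.
Proof.
by move=> N; rewrite reflexion_cartan /ca /da /db (negbTE N) /=; field.
Qed.

Lemma Z2_add11 : (1 + 1 : 'Z_2) = 0. Proof. exact: val_inj. Qed.

Lemma reflexionK u x : reflexion (reflexion u x) x = u.
Proof.
have [E|N] := eqVneq (cartan u x x) 0; last first.
  have A' := fun y z => @reflexion_cartan_an u x y z N.
  apply: rootDatum_eq; apply/ffunP => y; rewrite ffunE A' N.
  - by rewrite reflexion_a_x A' ffunE N scalerN opprK subrK.
  - by rewrite reflexion_b_x A' ffunE N scalerN opprK subrK.
  - by rewrite ffunE N.
have Ex z : cartan (reflexion u x) x z = - cartan u x z.
  by rewrite reflexion_cartan_x E eqxx.
apply: rootDatum_eq; apply/ffunP => y; rewrite ffunE !Ex oppr_eq0 E eqxx /=.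
- have [->|nyx] := eqVneq y x; first by rewrite reflexion_a_x opprK.
  rewrite reflexion_a_x ffunE E eqxx (negbTE nyx) oppr_eq0 /=.
  case: (eqVneq (cartan u x y) 0) => //= _; rewrite reflexion_cartan_xr //.
  by rewrite invrN mulrNN scalerN addrK.
- have [->|nyx] := eqVneq y x; first by rewrite reflexion_b_x opprK.
  rewrite reflexion_b_x ffunE E eqxx (negbTE nyx) oppr_eq0 /=.
  by case: (eqVneq (cartan u x y) 0) => //= _; rewrite addrK.
- have [->|nyx] := eqVneq y x; first by rewrite ffunE eqxx E eqxx.
  rewrite ffunE E eqxx (negbTE nyx) oppr_eq0 /=.
  by case: (eqVneq (cartan u x y) 0) => //= _; rewrite -addrA Z2_add11 addr0.
Qed.

Lemma reflexion_p_x u x : rd_p (reflexion u x) x = rd_p u x.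
Proof. by rewrite ffunE eqxx !if_same. Qed.

Lemma reflectable_reflexion u x : reflectable u x -> reflectable (reflexion u x) x.
Proof.
case=> [[E p1]|[N p0 n]|[N p1 n]].
- by apply: Or31; rewrite reflexion_p_x reflexion_cartan_x E eqxx oppr0.
- by apply: Or32; rewrite reflexion_p_x; split=> // [|y]; rewrite !reflexion_cartan_an //; exact: n.
- by apply: Or33; rewrite reflexion_p_x; split=> // [|y]; rewrite !reflexion_cartan_an //; exact: n.
Qed.

Lemma walk_cat u s t : walk u (s ++ t) = walk (walk u s) t.
Proof. by elim: s u => //= x s IH u; rewrite IH. Qed.

Lemma is_walk_cat u s t : is_walk u (s ++ t) <-> is_walk u s /\ is_walk (walk u s) t.
Proof.
elim: s u => [|x s IH] u /=; first by split=> // -[].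
by rewrite IH; split=> [[r []]|[[]]].
Qed.

Lemma is_iso_walk_cat u s t :
  is_iso_walk u (s ++ t) <-> is_iso_walk u s /\ is_iso_walk (walk u s) t.
Proof.
elim: s u => [|x s IH] u /=; first by split=> // -[].
by split=> [[r i /IH[]]|[[r i ws wt]]] //; split=> //; apply/IH.
Qed.

Lemma iso_walk u s : is_iso_walk u s -> is_walk u s.
Proof. by elim: s u => //= x s IH u [r _ /IH]. Qed.

Lemma walk_rev u s : is_walk u s ->
  is_walk (walk u s) (rev s) /\ walk (walk u s) (rev s) = u.
Proof.
elim: s u => //= x s IH u [r /IH[w e]]; rewrite rev_cons -cats1.
split; last by rewrite walk_cat e /= reflexionK.
by apply/is_walk_cat; rewrite e; split=> //=; split=> //; exact: reflectable_reflexion.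
Qed.

Lemma iso_walk_rev u s : is_iso_walk u s -> is_iso_walk (walk u s) (rev s).
Proof.
elim: s u => //= x s IH u [r i w]; have [_ e] := walk_rev (iso_walk w).
rewrite rev_cons -cats1; apply/is_iso_walk_cat; split; first exact: IH.
rewrite e /=; split=> //; first exact: reflectable_reflexion.
by rewrite reflexion_cartan_x i eqxx oppr0.
Qed.

Section Twist.
Variables (d : X -> K) (d0 : forall x, d x != 0).
Variables (phi : {linear h -> h}) (psi : {linear dual h -> dual h}).

Definition twist u w : Prop :=
  [/\ forall x, rd_a w x = d x *: phi (rd_a u x),
      forall x, rd_b w x = psi (rd_b u x),
      rd_p w = rd_p u &
      forall x y, cartan w x y = d x * cartan u x y].

Section Step.
Variables (u w : rootDatum) (x : X).
Hypothesis t : twist u w.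

Let A0 y z : (cartan w y z == 0) = (cartan u y z == 0).
Proof. by case: t => _ _ _ ->; rewrite mulf_eq0 (negbTE (d0 y)). Qed.

Let caE y : ca w x y = ca u x y. Proof. by rewrite /ca A0. Qed.

Let dbE y : db w x y = db u x y.
Proof.
rewrite /db !A0; case: t => _ _ _ A; rewrite !A; have dx := d0 x.
by case: (eqVneq (cartan u x x) 0) => //= N; field; rewrite N dx.
Qed.

Let daE y : da w x y = d y / d x * da u x y.
Proof.
rewrite /da !A0; case: t => _ _ _ A; rewrite !A; have dx := d0 x.
case: (eqVneq (cartan u x x) 0) => [_|N] /=; last by field; rewrite N dx.
case: (eqVneq y x) => _; first by rewrite mulr0.
by case: (eqVneq (cartan u x y) 0) => [_|N]; [rewrite mulr0 | field; rewrite N dx].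
Qed.

Lemma twist_reflexion : twist (reflexion u x) (reflexion w x).
Proof.
have [ta tb tp tA] := t; split.
- move=> y; rewrite !reflexion_aE caE daE !ta linearD !linearZ /= scalerDr !scalerA.
  by congr (_ *: _ + _ *: _); have dx := d0 x; field.
- by move=> y; rewrite !reflexion_bE caE dbE !tb linearD !linearZ /=.
- by apply/ffunP => y; rewrite !ffunE !A0 tp.
- by move=> y z; rewrite !reflexion_cartan !caE !daE !dbE !tA; have dx := d0 x; field.
Qed.

Lemma twist_iso : cartan u x x = 0 -> cartan w x x = 0.
Proof. by move/eqP; rewrite -A0 => /eqP. Qed.

Lemma twist_reflectable : reflectable u x -> reflectable w x.
Proof.
have [_ _ tp tA] := t; have dx := d0 x.
have q y : cartan u x x != 0 -> cartan w x y / cartan w x x = cartan u x y / cartan u x x.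
  by move=> N; rewrite !tA; field; rewrite N dx.
case=> [[E p1]|[N p0 n]|[N p1 n]].
- by apply: Or31; rewrite tp (twist_iso E).
- apply: Or32; rewrite A0 tp; split=> // y nyx.
  by rewrite -mulrA q // mulrA; exact: n.
- by apply: Or33; rewrite A0 tp; split=> // y nyx; rewrite q //; exact: n.
Qed.

End Step.

Lemma twist_walk u w s : twist u w -> twist (walk u s) (walk w s).
Proof. by elim: s u w => //= x s IH u w t; apply: IH; exact: twist_reflexion. Qed.

Lemma twist_is_walk u w s : twist u w -> is_walk u s -> is_walk w s.
Proof.
elim: s u w => //= x s IH u w t [r ws]; split; first exact: twist_reflectable t r.
by apply: IH ws; exact: twist_reflexion.
Qed.

Lemma twist_is_iso_walk u w s : twist u w -> is_iso_walk u s -> is_iso_walk w s.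
Proof.
elim: s u w => //= x s IH u w t [r i ws]; split; first exact: twist_reflectable t r.
  exact: twist_iso t i.
by apply: IH ws; exact: twist_reflexion.
Qed.

End Twist.

Lemma D_equiv_twist u w : D_equiv w u ->
  exists d (phi : {linear h -> h}) (psi : {linear dual h -> dual h}),
    (forall x, d x != 0) /\ twist d phi psi u w.
Proof.
case=> ep [d [d0 A]]; exists d.
exists (lin_ext (rd_a u) (fun x => (d x)^-1 *: rd_a w x)).
exists (lin_ext (rd_b u) (rd_b w)); split=> //; split=> // x.
- by rewrite /= lin_extE ?rd_a_free // scalerA mulfV // scale1r.
- by rewrite /= lin_extE ?rd_b_free.
Qed.

Lemma twist_D_equiv d phi psi u w :
  (forall x, d x != 0) -> twist d phi psi u w -> D_equiv w u.
Proof. by move=> d0 [_ _ tp tA]; split=> //; exists d. Qed.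

Lemma twist_det d phi psi u w w' :
  twist d phi psi u w -> twist d phi psi u w' -> w = w'.
Proof.
case=> [ta tb tp _] [ta' tb' tp' _].
apply: rootDatum_eq; last by rewrite tp tp'.
  by apply/ffunP => x; rewrite ta ta'.
by apply/ffunP => x; rewrite tb tb'.
Qed.

Lemma D_equiv_refl u : D_equiv u u.
Proof.
split=> //; exists (fun=> 1); split=> [x|x y]; first exact: oner_neq0.
by rewrite mul1r.
Qed.

Lemma D_equiv_sym u w : D_equiv u w -> D_equiv w u.
Proof.
case=> p [d [d0 A]]; split=> //; exists (fun x => (d x)^-1); split=> [x|x y].
  by rewrite invr_eq0.
by rewrite A mulKf.
Qed.

Lemma D_equiv_trans u w t : D_equiv u w -> D_equiv w t -> D_equiv u t.
Proof.
case=> p [d [d0 A]] [p' [d' [d0' A']]]; split; first by rewrite p.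
exists (fun x => d x * d' x); split=> [x|x y]; first by rewrite mulf_neq0.
by rewrite A A' mulrA.
Qed.

Lemma is_walk_translate v v' s : D_equiv v' v -> is_walk v s -> is_walk v' s.
Proof. by move=> /D_equiv_twist[d [phi [psi [d0 t]]]]; exact: twist_is_walk t. Qed.

Lemma is_iso_walk_translate v v' s :
  D_equiv v' v -> is_iso_walk v s -> is_iso_walk v' s.
Proof. by move=> /D_equiv_twist[d [phi [psi [d0 t]]]]; exact: twist_is_iso_walk t. Qed.

Lemma walk_D_equiv v v' s : D_equiv v' v -> D_equiv (walk v' s) (walk v s).
Proof.
move=> /D_equiv_twist[d [phi [psi [d0 t]]]].
exact: twist_D_equiv d0 (twist_walk d0 s t).
Qed.

Lemma walk_indep v v' s t : D_equiv v' v -> walk v s = walk v t ->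
  walk v' s = walk v' t.
Proof.
move=> /D_equiv_twist[d [phi [psi [d0 tw]]]] e.
apply: (@twist_det d phi psi (walk v s)); first exact: twist_walk.
by rewrite e; exact: twist_walk.
Qed.

Lemma chosen_walkP v u : Sk_set v u ->
  is_walk v (chosen_walk v u) /\ walk v (chosen_walk v u) = u.
Proof.
case=> s ws es; exact: (@xgetPex _ [::] [set s | is_walk v s /\ walk v s = u]
  (ex_intro _ s (conj ws es))).
Qed.

Lemma translateE v v' s : D_equiv v' v -> is_walk v s ->
  translate v v' (walk v s) = walk v' s.
Proof.
move=> dv ws; apply: (walk_indep dv).
by have [] := @chosen_walkP v (walk v s) (ex_intro2 _ _ s ws erefl).
Qed.

Lemma translateP v v' u s : D_equiv v' v -> is_walk v s -> walk v s = u ->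
  translate v v' u = walk v' s.
Proof. by move=> dv ws <-; exact: translateE. Qed.

Lemma Sk_refl v : Sk_set v v. Proof. by exists [::]. Qed.

Lemma Sk_trans v u w : Sk_set v u -> Sk_set u w -> Sk_set v w.
Proof.
case=> s ws <- [t wt <-]; exists (s ++ t); last by rewrite walk_cat.
exact/is_walk_cat.
Qed.

Lemma Sk_sym v u : Sk_set v u -> Sk_set u v.
Proof. by case=> s /walk_rev[wr e] <-; exists (rev s). Qed.

Lemma Sk_translate v v' u : D_equiv v' v -> Sk_set v u -> Sk_set v' (translate v v' u).
Proof.
move=> dv [s ws <-]; rewrite translateE //; exists s => //.
exact: is_walk_translate ws.
Qed.

Lemma D_equiv_translate v v' u : D_equiv v' v -> Sk_set v u ->
  D_equiv (translate v v' u) u.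
Proof. by move=> dv [s ws <-]; rewrite translateE //; exact: walk_D_equiv. Qed.

Lemma Sp_refl v : Sp_set v v. Proof. by exists [::]. Qed.

Lemma Sp_Sk v u : Sp_set v u -> Sk_set v u.
Proof. by case=> s /iso_walk; exists s. Qed.

Lemma Sp_trans v u w : Sp_set v u -> Sp_set u w -> Sp_set v w.
Proof.
case=> s ws <- [t wt <-]; exists (s ++ t); last by rewrite walk_cat.
exact/is_iso_walk_cat.
Qed.

Lemma Sp_sym v u : Sp_set v u -> Sp_set u v.
Proof.
case=> s ws <-; exists (rev s); first exact: iso_walk_rev.
by have [] := walk_rev (iso_walk ws).
Qed.

Lemma Sp_translate v v' u : D_equiv v' v -> Sp_set v u -> Sp_set v' (translate v v' u).
Proof.
move=> dv [s ws <-]; rewrite translateE //; last exact: iso_walk.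
by exists s => //; exact: is_iso_walk_translate ws.
Qed.

Record Sk (v : rootDatum) := MkSk { Sk_val :> rootDatum; SkP : Sk_set v Sk_val }.

Record SkD (v : rootDatum) := MkSkD { SkD_val :> Sk v; SkDP : D_equiv SkD_val v }.

HB.instance Definition _ v := gen_eqMixin (SkD v).
HB.instance Definition _ v := gen_choiceMixin (SkD v).

Lemma SkD_eq v (u w : SkD v) : u = w :> rootDatum -> u = w.
Proof.
case: u w => [[u us] ud] [[w ws] wd] /= e; subst w.
by rewrite (Prop_irrelevance us ws) in ud *; rewrite (Prop_irrelevance ud wd).
Qed.

Section SkDGroup.
Variable v : rootDatum.
Implicit Types u : SkD v.

Fact SkD_one_subproof : D_equiv (MkSk (Sk_refl v)) v.
Proof. exact: D_equiv_refl. Qed.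
Definition SkD_one : SkD v := MkSkD SkD_one_subproof.

Fact SkD_mul_Sk u1 u2 : Sk_set v (translate v u1 u2).
Proof. exact: Sk_trans (SkP u1) (Sk_translate (SkDP u1) (SkP u2)). Qed.
Fact SkD_mul_D u1 u2 : D_equiv (MkSk (SkD_mul_Sk u1 u2)) v.
Proof. exact: D_equiv_trans (D_equiv_translate (SkDP u1) (SkP u2)) (SkDP u2). Qed.
Definition SkD_mul u1 u2 : SkD v := MkSkD (SkD_mul_D u1 u2).

Fact SkD_inv_Sk u : Sk_set v (translate u v v).
Proof. exact: Sk_translate (D_equiv_sym (SkDP u)) (Sk_sym (SkP u)). Qed.
Fact SkD_inv_D u : D_equiv (MkSk (SkD_inv_Sk u)) v.
Proof. exact: D_equiv_translate (D_equiv_sym (SkDP u)) (Sk_sym (SkP u)). Qed.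
Definition SkD_inv u : SkD v := MkSkD (SkD_inv_D u).

Fact SkD_mulA : associative SkD_mul.
Proof.
move=> u1 u2 u3; apply: SkD_eq => /=.
have [s2 w2 e2] := SkP u2; have [s3 w3 e3] := SkP u3.
have d1 := SkDP u1; have d2 := SkDP u2.
have -> : translate v u2 u3 = walk v (s2 ++ s3).
  by rewrite -e3 translateE // walk_cat e2.
rewrite translateE //; last first.
  by apply/is_walk_cat; rewrite e2; split=> //; exact: is_walk_translate w3.
rewrite walk_cat -e3 translateE //; first by rewrite -e2 translateE.
exact: SkD_mul_D.
Qed.

Fact SkD_mul1 : left_id SkD_one SkD_mul.
Proof.
move=> u; apply: SkD_eq => /=; have [s ws <-] := SkP u.
by rewrite translateE //; exact: D_equiv_refl.
Qed.

Fact SkD_mulr1 : right_id SkD_one SkD_mul.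
Proof.
by move=> u; apply: SkD_eq; exact: (@translateE v u [::] (SkDP u) I).
Qed.

Lemma SkD_invE u t : is_walk u t -> walk u t = v -> SkD_inv u = walk v t :> rootDatum.
Proof.
by move=> wt et; exact: translateP (D_equiv_sym (SkDP u)) wt et.
Qed.

Lemma SkD_mulE u1 u2 s : is_walk v s -> walk v s = u2 ->
  SkD_mul u1 u2 = walk u1 s :> rootDatum.
Proof. by move=> ws es; exact: translateP (SkDP u1) ws es. Qed.

Fact SkD_mulV : left_inverse SkD_one SkD_inv SkD_mul.
Proof.
move=> u; apply: SkD_eq; have [s ws es] := SkP u.
have [t wt et] := Sk_sym (SkP u); have dv := D_equiv_sym (SkDP u).
rewrite (SkD_mulE _ ws es) (SkD_invE wt et) -walk_cat.
by rewrite (walk_indep (t := [::]) dv) // walk_cat et es.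
Qed.

Fact SkD_mulrV : right_inverse SkD_one SkD_inv SkD_mul.
Proof.
move=> u; apply: SkD_eq; have [t wt et] := Sk_sym (SkP u).
have wt' := is_walk_translate (D_equiv_sym (SkDP u)) wt.
by rewrite (SkD_mulE _ wt' (esym (SkD_invE wt et))).
Qed.

HB.instance Definition _ :=
  isGroup.Build (SkD v) SkD_mulA SkD_mul1 SkD_mulr1 SkD_mulV SkD_mulrV.

Definition SpD_pred : {pred SkD v} := fun u => `[< Sp_set v u >].

Fact SpD_group_closed : group_closed SpD_pred.
Proof.
split; first exact/asboolP/Sp_refl.
move=> u1 u2 /asboolP s1 /asboolP s2; apply/asboolP.
apply: (Sp_trans s1); apply: (Sp_translate (SkDP u1)).
exact: Sp_translate (D_equiv_sym (SkDP u2)) (Sp_sym s2).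
Qed.

Record SpD := MkSpD { SpD_val :> SkD v; SpDP : SpD_pred SpD_val }.

HB.instance Definition _ := [isSub for SpD_val].
HB.instance Definition _ := [Choice of SpD by <:].
HB.instance Definition _ :=
  SubChoice_isSubGroup.Build (SkD v) SpD_pred SpD SpD_group_closed.

End SkDGroup.

Definition Vb_space (v : rootDatum) : {vspace dual h} := <<codom (rd_b v)>>%VS.
Definition Vb (v : rootDatum) : vectType K := subvs_of (Vb_space v).

Lemma Vb_space_Sk v u : Sk_set v u -> Vb_space u = Vb_space v.
Proof.
case=> s _ <-; elim: s v => //= x s IH v; rewrite IH.
exact: shear_span (reflexion_b_x v x) (@reflexion_b_y v x).
Qed.

Lemma rd_b_Vb v u x : Sk_set v u -> rd_b u x \in Vb_space v.
Proof. by move=> /Vb_space_Sk <-; exact: codom_span. Qed.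

Definition sigma_lin (v u : rootDatum) : 'End(Vb v) :=
  linfun (lin_ext (rd_b v) (fun x => vsproj (Vb_space v) (rd_b u x)) \o vsval).

End RootDatum.

Record GL (K : fieldType) (V : vectType K) :=
  MkGL { GL_val :> 'End(V); GLP : lker GL_val == 0%VS }.

Section GLGroup.
Variables (K : fieldType) (V : vectType K).

HB.instance Definition _ := [isSub for @GL_val K V].
HB.instance Definition _ := [Choice of GL V by <:].

Implicit Types f g : GL V.

Fact GL_one_subproof : lker (\1%VF : 'End(V)) == 0%VS.
Proof. by apply/lker0P => x y; rewrite !id_lfunE. Qed.
Definition GL_one := MkGL GL_one_subproof.

Fact GL_mul_subproof f g : lker (f \o g)%VF == 0%VS.
Proof. by apply/lker0P => x y; rewrite !comp_lfunE => /(lker0P (GLP f))/(lker0P (GLP g)). Qed.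
Definition GL_mul f g := MkGL (GL_mul_subproof f g).

Fact GL_inv_subproof f : lker (f^-1)%VF == 0%VS.
Proof.
apply/lker0P; apply: (@can_inj _ _ _ f) => x.
by rewrite -comp_lfunE lker0_compfV ?GLP // id_lfunE.
Qed.
Definition GL_inv f := MkGL (GL_inv_subproof f).

Fact GL_mulA : associative GL_mul.
Proof. by move=> f g k; apply: val_inj; rewrite /= comp_lfunA. Qed.
Fact GL_mul1 : left_id GL_one GL_mul.
Proof. by move=> f; apply: val_inj; rewrite /= comp_lfun1l. Qed.
Fact GL_mulr1 : right_id GL_one GL_mul.
Proof. by move=> f; apply: val_inj; rewrite /= comp_lfun1r. Qed.
Fact GL_mulV : left_inverse GL_one GL_inv GL_mul.
Proof. by move=> f; apply: val_inj; rewrite /= lker0_compVf ?GLP. Qed.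
Fact GL_mulrV : right_inverse GL_one GL_inv GL_mul.
Proof. by move=> f; apply: val_inj; rewrite /= lker0_compfV ?GLP. Qed.

HB.instance Definition _ :=
  isGroup.Build (GL V) GL_mulA GL_mul1 GL_mulr1 GL_mulV GL_mulrV.

End GLGroup.

Record Aut (T : Type) := MkAut { Aut_val :> T -> T; AutP : bijective Aut_val }.

HB.instance Definition _ T := gen_eqMixin (Aut T).
HB.instance Definition _ T := gen_choiceMixin (Aut T).

Section AutGroup.
Variable T : Type.
Implicit Types f g : Aut T.

Lemma Aut_eq f g : f =1 g -> f = g.
Proof.
case: f g => [f fb] [g gb] /= /funext e; subst g.
by rewrite (Prop_irrelevance fb gb).
Qed.

Definition Aut_one : Aut T := MkAut (Bijective (frefl id) (frefl id)).
Definition Aut_mul f g : Aut T := MkAut (bij_comp (AutP f) (AutP g)).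

Fact Aut_inv_ex f : exists g : Aut T, cancel f g /\ cancel g f.
Proof. by case: (AutP f) => g fK gK; exists (MkAut (Bijective gK fK)). Qed.
Definition Aut_inv f : Aut T := projT1 (cid (Aut_inv_ex f)).

Fact Aut_mulA : associative Aut_mul. Proof. by move=> f g k; exact: Aut_eq. Qed.
Fact Aut_mul1 : left_id Aut_one Aut_mul. Proof. by move=> f; exact: Aut_eq. Qed.
Fact Aut_mulr1 : right_id Aut_one Aut_mul. Proof. by move=> f; exact: Aut_eq. Qed.
Fact Aut_mulV : left_inverse Aut_one Aut_inv Aut_mul.
Proof. by move=> f; apply: Aut_eq; case: (projT2 (cid (Aut_inv_ex f))). Qed.
Fact Aut_mulrV : right_inverse Aut_one Aut_inv Aut_mul.
Proof. by move=> f; apply: Aut_eq; case: (projT2 (cid (Aut_inv_ex f))). Qed.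

HB.instance Definition _ :=
  isGroup.Build (Aut T) Aut_mulA Aut_mul1 Aut_mulr1 Aut_mulV Aut_mulrV.

End AutGroup.

Section Sigma.
Variables (K : numFieldType) (X : finType) (h : vectType K).
Implicit Types v u : rootDatum X h.

Lemma sigma_linE v u (w : Vb v) : Sk_set v u ->
  vsval (sigma_lin v u w) = \sum_x fcoord (rd_b v) x (vsval w) *: rd_b u x.
Proof.
move=> su; rewrite lfunE /= /lin_ext linear_sum; apply: eq_bigr => x _.
by rewrite linearZ /= vsprojK // rd_b_Vb.
Qed.

Fact sigma_lker v (u : Sk v) : lker (sigma_lin v u) == 0%VS.
Proof.
apply/lker0P => w w' /(congr1 vsval); rewrite !sigma_linE; [|exact: SkP..].
move=> e; have c x : fcoord (rd_b v) x (vsval w) = fcoord (rd_b v) x (vsval w').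
  have q (k : X -> K) : fcoord (rd_b u) x (\sum_y k y *: rd_b u y) = k x.
    rewrite /fcoord linear_sum (bigD1 x) //= big1 ?addr0 => [|y nyx];
      rewrite linearZ /= -/(fcoord _ _ _) fcoord_free ?rd_b_free //.
      by rewrite eqxx mulr1.
    by rewrite (negbTE nyx) mulr0.
  by rewrite -(q (fun y => fcoord (rd_b v) y (vsval w))) e q.
apply: subvs_inj; rewrite (fcoord_span (subvsP w)) (fcoord_span (subvsP w')).
by apply: eq_bigr => x _; rewrite c.
Qed.

Definition sigma_b v (u : Sk v) : GL (Vb v) := MkGL (sigma_lker u).

Lemma sigma_bE v (u : Sk v) x :
  vsval (sigma_b u (vsproj (Vb_space v) (rd_b v x))) = rd_b u x.
Proof.
have bV := rd_b_Vb x (Sk_refl v).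
rewrite /= lfunE /= vsprojK // lin_extE ?rd_b_free // vsprojK //.
exact/rd_b_Vb/SkP.
Qed.

(* Principal roots belong to V_b, so this is a set of vectors of V_b. *)
Definition Sigma_pr v : set (Vb v) :=
  [set alpha | exists u x, [/\ Sp_set v u, reflectable u x, cartan u x x != 0 &
                             vsval alpha = rd_b u x]].

Arguments Sigma_pr : clear implicits.

(* Coordinates in the lattice spanned by the b_v(x), and junk value 0 outside.
   On that lattice [parity] is the homomorphism extending p: see [parity_sum]
   and [parity_b]. *)
Definition int_coord v (alpha : Vb v) : {ffun X -> int} :=
  xget 0 [set n : {ffun X -> int} | vsval alpha = \sum_x rd_b v x *~ n x].

Definition parity v (alpha : Vb v) : 'Z_2 :=
  \sum_x rd_p v x *~ int_coord alpha x.

Lemma parity_sum v (alpha : Vb v) (n : {ffun X -> int}) :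
  vsval alpha = \sum_x rd_b v x *~ n x -> parity alpha = \sum_x rd_p v x *~ n x.
Proof.
move=> e; have e' := @xgetPex _ (0 : {ffun X -> int})
  [set n : {ffun X -> int} | vsval alpha = \sum_x rd_b v x *~ n x] (ex_intro _ n e).
rewrite /parity; apply: eq_bigr => x _; congr (_ *~ _).
apply/eqP; rewrite -(eqr_int K); apply/eqP.
have co m : vsval alpha = \sum_x rd_b v x *~ m x ->
    fcoord (rd_b v) x (vsval alpha) = (m x)%:~R.
  move=> ->; rewrite /fcoord linear_sum (bigD1 x) //= big1 => [|y nyx].
    rewrite addr0 -scaler_int linearZ /= -/(fcoord _ _ _) fcoord_free ?rd_b_free //.
    by rewrite eqxx /= mulr1.
  rewrite -scaler_int linearZ /= -/(fcoord _ _ _) fcoord_free ?rd_b_free //.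
  by rewrite (negbTE nyx) mulr0.
by rewrite -(co _ e) -(co _ e').
Qed.

Section ParityRoots.
Variable v : rootDatum X h.

Let lat (beta : dual h) (q : 'Z_2) := exists n : {ffun X -> int},
  beta = \sum_x rd_b v x *~ n x /\ q = \sum_x rd_p v x *~ n x.

Let latD beta q beta' q' : lat beta q -> lat beta' q' -> lat (beta + beta') (q + q').
Proof.
case=> [n [-> ->]] [m [-> ->]]; exists (n + m); rewrite -!big_split /=.
by split; apply: eq_bigr => x _; rewrite ffunE mulrzDr.
Qed.

Let latZ beta q (k : int) : lat beta q -> lat (beta *~ k) (q *~ k).
Proof.
case=> [n [-> ->]]; exists [ffun x => n x * k].
rewrite !mulrz_suml; split; apply: eq_bigr => x _; by rewrite ffunE mulrzA.
Qed.

Let lat_reflexion u x : (forall y, lat (rd_b u y) (rd_p u y)) -> reflectable u x ->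
  forall y, lat (rd_b (reflexion u x) y) (rd_p (reflexion u x) y).
Proof.
move=> L r y; have [->|nyx] := eqVneq y x.
  rewrite reflexion_b_x reflexion_p_x; have := latZ (- 1) (L x).
  rewrite !mulrNz !mulr1z; congr (lat _ _).
  by apply/eqP; rewrite eq_sym -subr_eq0 opprK -mulr2n -mulr_natr pchar_Zp ?mulr0.
rewrite !ffunE (negbTE nyx); case: r => [[-> p1]|[N p0 n]|[N p1 n]].
- rewrite eqxx /=; case: ifP => // _; rewrite -p1; exact: latD.
- rewrite N; have [k ->] := n _ nyx; rewrite scaleNr opprK scaler_nat.
  have := latD (L y) (latZ k%:Z (L x)); rewrite p0 mul0rz addr0.
  by rewrite -pmulrn.
- rewrite N -mulrA; have [k ->] := n _ nyx.
  have := latD (L y) (latZ (2 * k)%N%:Z (L x)).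
  rewrite mulrN scaleNr opprK -natrM scaler_nat -!pmulrn.
  congr (lat _ _); rewrite -mulr_natr natrM.
  by rewrite [2%:R](pchar_Zp (p := 2)) // mul0r mulr0 addr0.
Qed.

Lemma parity_b (alpha : Vb v) u x : Sk_set v u -> vsval alpha = rd_b u x ->
  parity alpha = rd_p u x.
Proof.
case=> s ws <- e; suff L : forall y, lat (rd_b (walk v s) y) (rd_p (walk v s) y).
  by have [n [en ->]] := L x; apply: parity_sum; rewrite e.
have L0 : forall y, lat (rd_b v y) (rd_p v y).
  move=> y; exists [ffun x => (x == y)%:R].
  split; rewrite (bigD1 y) //= ffunE eqxx mulr1z big1 ?addr0 // => z nzy.
    by rewrite ffunE (negbTE nzy) mulr0z.
  by rewrite ffunE (negbTE nzy) mulr0z.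
suff L w : (forall y, lat (rd_b w y) (rd_p w y)) -> is_walk w s ->
    forall y, lat (rd_b (walk w s) y) (rd_p (walk w s) y) by exact: L.
elim: s w {ws e} => //= z s IH w L [r ws].
by apply: IH ws; exact: lat_reflexion.
Qed.

End ParityRoots.

(* The vector alpha^vee, computed from a chosen representation alpha = b_u(x); junk
   value 0 when alpha is not a principal root. *)
Definition coroot v (alpha : Vb v) : h :=
  xget 0 [set c | exists u x, [/\ Sp_set v u, reflectable u x, cartan u x x != 0,
    vsval alpha = rd_b u x & c = (2 / cartan u x x) *: rd_a u x]].

Definition Dynkin v : set (Aut (Sigma_pr v)) :=
  [set psi | forall alpha beta : Sigma_pr v,
     parity (val (psi alpha)) = parity (val alpha) /\
     vsval (val beta) (coroot (val alpha)) =
       vsval (val (psi beta)) (coroot (val (psi alpha)))].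
End Sigma.

Arguments Sigma_pr {K X h} v alpha.
Arguments Dynkin {K X h} v psi.

(* Main.v *)
(** Everything rests on the sign coherence of real roots: if [v] is admissible
    and [u] is in the skeleton of [v], then each [b_u(x)] is a combination of the
    [b_v(z)] with natural coefficients, or the opposite of one.  As for Coxeter
    groups, this is proved by induction on the graph distance from [v] to [u],
    which reduces it to alternating walks in two letters [x], [y].  In rank two,
    either the coefficients of successive roots stay nonnegative, or the product
    [k l] of the two reflexion coefficients is [0], [1], [2] or [3] and the two
    alternating walks of length [2], [3], [4] or [6] have the same endpoint, or the
    walk is stopped early by a non-reflectable letter.

    A shortest walk from [v] to [u] ends with a letter [x] such that [b_u(x)] is
    negative with respect to [v]; hence [b_u = b_v] forces [u = v], which is the
    injectivity of [u |-> sigma_b^u].  Sign coherence also makes the pairing of a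
    coroot with real roots independent of choices, because two reflections along
    the same root differ by a transvection.  The rest follows by transporting
    walks from [v] to the walks with the same marks from [u]. *)

Require Import Defs.
From HB Require Import structures.
From mathcomp Require Import all_boot all_order all_algebra.
From mathcomp Require Import boolp classical_sets reals.
From mathcomp Require Import complex.
From mathcomp Require Import ring zify.

Set Implicit Arguments.
Unset Strict Implicit.
Unset Printing Implicit Defensive.

Import Order.TTheory GRing.Theory Num.Theory.
Local Open Scope ring_scope.

(** * Cartan data and their change under one reflexion *)

Section CartanData.
Variables (K : numFieldType) (X : finType) (h : vectType K).
Implicit Types u v w : rootDatum X h.

Lemma admissible_Sk v u : admissible v -> Sk_set v u -> admissible u.
Proof. by move=> adm su w sw; apply: adm; exact: Sk_trans sw. Qed.

Lemma Sk_reflexion u x : reflectable u x -> Sk_set u (reflexion u x).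
Proof. by move=> r; exists [:: x]. Qed.

(** This is [D_equiv] with trivial scaling. An anisotropic reflexion preserves the Cartan datum
    exactly, and reflectability and the coefficients [db] depend on nothing else. *)
Definition same_cartan u w : Prop :=
  rd_p u = rd_p w /\ forall x y, cartan u x y = cartan w x y.

Lemma same_cartan_refl u : same_cartan u u.
Proof. by []. Qed.

Lemma same_cartan_sym u w : same_cartan u w -> same_cartan w u.
Proof. by case=> p A; split. Qed.

Lemma same_cartan_trans u w t :
  same_cartan u w -> same_cartan w t -> same_cartan u t.
Proof. by case=> p A [p' A']; split=> [|x y]; rewrite ?p ?A. Qed.

Lemma same_cartan_D_equiv u w : same_cartan u w -> D_equiv u w.
Proof.
case=> p A; split=> //; exists (fun=> 1).
by split=> [x|x y]; rewrite ?oner_neq0 // mul1r.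
Qed.

Lemma same_cartan_reflectable u w x :
  same_cartan u w -> reflectable w x -> reflectable u x.
Proof.
by move=> /same_cartan_D_equiv e r; have [] := @is_walk_translate _ _ _ _ _ [:: x] e (conj r I).
Qed.

Lemma same_cartan_reflexion u w x :
  same_cartan u w -> same_cartan (reflexion u x) (reflexion w x).
Proof.
case=> p A; split; first by apply/ffunP => y; rewrite !ffunE !A p.
by move=> y z; rewrite !reflexion_cartan /ca /da /db !A.
Qed.

Lemma same_cartan_anisotropic u x :
  cartan u x x != 0 -> same_cartan (reflexion u x) u.
Proof.
move=> N; split; first by apply/ffunP => y; rewrite ffunE N.
by move=> y z; rewrite reflexion_cartan_an.
Qed.

Lemma db_same_cartan u w x y : same_cartan u w -> db u x y = db w x y.
Proof. by case=> _ A; rewrite /db !A. Qed.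

Lemma rd_b_reflexion u x y : y != x ->
  rd_b (reflexion u x) y = rd_b u y + db u x y *: rd_b u x.
Proof. by move=> nyx; rewrite reflexion_bE /ca (negbTE nyx) andbF scale1r. Qed.

Lemma rd_a_reflexion u x y : y != x ->
  rd_a (reflexion u x) y = rd_a u y + da u x y *: rd_a u x.
Proof. by move=> nyx; rewrite reflexion_aE /ca (negbTE nyx) andbF scale1r. Qed.

Lemma isotropic_parity u x : reflectable u x -> cartan u x x = 0 -> rd_p u x = 1.
Proof. by case=> [[]|[]|[]] // N _ _ E; rewrite E eqxx in N. Qed.

Lemma reflectable_isotropic u x : cartan u x x = 0 -> rd_p u x = 1 -> reflectable u x.
Proof. by move=> *; apply: Or31. Qed.

(** Treats both parities at once: $k=-2a_{xy}/a_{xx}$, which is twice a natural number when $x$ is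
    odd. *)
Lemma reflectable_anisotropic u x y :
  reflectable u x -> cartan u x x != 0 -> y != x ->
  exists2 k : nat, cartan u x y *+ 2 = - (cartan u x x *+ k) &
    rd_p u x = 1 -> ~~ odd k.
Proof.
case=> [[-> _]|[N p0 n]|[N p1 n]] //; first by rewrite eqxx.
- move=> _ /n[k e]; exists k; last by rewrite p0.
  move/(congr1 (fun t => t * cartan u x x)): e; rewrite divfK // => e.
  by rewrite -mulr_natl e mulNr mulr_natl.
- move=> _ /n[k e]; exists (2 * k)%N; last by rewrite oddM.
  move/(congr1 (fun t => t * cartan u x x)): e; rewrite divfK // => ->.
  by rewrite mulNr mulNrn mulr_natl mulrnA mulrnAC.
Qed.

Lemma db_nat u x y : reflectable u x -> y != x -> exists k : nat, db u x y = k%:R.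
Proof.
move=> r nyx; have [E|N] := eqVneq (cartan u x x) 0.
  rewrite /db E eqxx (negbTE nyx) /=.
  by case: ifP => _; [exists 0%N | exists 1%N].
have [k e _] := reflectable_anisotropic r N nyx; exists k.
by rewrite /db N mulr_natl e mulNr opprK -[_ x x *+ k]mulr_natl mulfK.
Qed.

Lemma db_neq0 u x y : y != x -> cartan u x y != 0 -> db u x y != 0.
Proof.
move=> nyx a; rewrite /db (negbTE nyx) (negbTE a).
case: ifP => N; last exact: oner_neq0.
by rewrite oppr_eq0 mulf_neq0 ?invr_eq0 ?mulf_neq0 // pnatr_eq0.
Qed.

Lemma da_db u x y : cartan u x y != 0 ->
  da u x y = cartan u y x / cartan u x y * db u x y.
Proof.
move=> a; rewrite /da /db (negbTE a).
case: (eqVneq (cartan u x x) 0) => [E|N] /=; last by field; rewrite a N.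
by case: ifP => _; rewrite ?mulr0 ?mulr1.
Qed.

Lemma reflexion_cartan_col u x y : y != x ->
  cartan (reflexion u x) y x =
  if cartan u x x == 0 then - cartan u y x else cartan u y x.
Proof.
by move=> n; case: eqVneq => E; [exact: reflexion_cartan_xr | exact: reflexion_cartan_an].
Qed.

Definition linked u x y : bool := (cartan u x y != 0) && (cartan u y x != 0).

Lemma linkedC u x y : linked u x y = linked u y x.
Proof. by rewrite /linked andbC. Qed.

Lemma linked_reflexion u x y : y != x -> linked u x y -> linked (reflexion u x) x y.
Proof.
move=> n /andP[a b]; rewrite /linked reflexion_cartan_x reflexion_cartan_col //.
by case: ifP; rewrite ?oppr_eq0 a b.
Qed.

Lemma reflexion_cartan_isotropic u x y : y != x -> cartan u x x = 0 ->
  cartan u x y != 0 ->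
  cartan (reflexion u x) y y = cartan u y y + cartan u y x *+ 2.
Proof.
move=> n E a; rewrite reflexion_cartan /ca /da /db E eqxx (negbTE n) (negbTE a) /=.
by field.
Qed.

End CartanData.

(** * Linked letters at which all reflexions stay possible *)

Section Dihedral.
Variables (K : numFieldType) (X : finType) (h : vectType K).
Implicit Types u v w : rootDatum X h.

(** With $f=a_{xz}$, $g=a_{yz}$, $s=a_{xy}$, $t=a_{yx}$, the ratio to control at $z$ is
    $g/t+f/s+[f\ne0]$ after the reflexion at $x$, and $g/t+f/s+[g\ne0]$ after the one at $y$. The
    second exceeds the first only if $f=0\ne g$; the first is then a nonzero nonpositive integer, so
    adding one is harmless. *)
Lemma isotropic_pair_reflectable w x y : y != x -> linked w x y ->
  reflectable w x -> reflectable w y -> cartan w x x = 0 -> cartan w y y = 0 ->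
  reflectable (reflexion w x) y -> reflectable (reflexion w y) x.
Proof.
move=> n /andP[a b] rx ry Ex Ey.
have nxy : x != y by rewrite eq_sym.
have px : rd_p (reflexion w y) x = 0.
  rewrite ffunE Ey eqxx (negbTE nxy) (negbTE b) (isotropic_parity rx Ex).
  exact: Z2_add11.
have py : rd_p (reflexion w x) y = 0.
  rewrite ffunE Ex eqxx (negbTE n) (negbTE a) (isotropic_parity ry Ey).
  exact: Z2_add11.
have Ay : cartan (reflexion w x) y y = cartan w y x *+ 2.
  by rewrite reflexion_cartan_isotropic // Ey add0r.
have Ax : cartan (reflexion w y) x x = cartan w x y *+ 2.
  by rewrite reflexion_cartan_isotropic // Ex add0r.
have two t : t != 0 :> K -> t *+ 2 != 0 by move=> t0; rewrite -mulr_natl mulf_neq0 ?pnatr_eq0.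
rewrite /reflectable py px Ay Ax; case=> [[/eqP]|[_ _ H]|[_ /eqP]] //.
apply: Or32; split=> // [|z nzx]; first exact: two.
have [->|nzy] := eqVneq z y.
  exists 1%N; rewrite reflexion_cartan_col // Ey eqxx -mulr_natl.
  by field; rewrite a.
have [k] := H z nzy.
rewrite !reflexion_cartan /ca /da /db Ex Ey !eqxx (negbTE n) (negbTE nxy) (negbTE nzx).
rewrite (negbTE nzy) (negbTE a) (negbTE b) /=.
set f := cartan w x z; set g := cartan w y z; set s := cartan w x y.
set t := cartan w y x.
rewrite -/s -/t in a b |- *.
have [f0|f0] := eqVneq f 0; have [g0|g0] := eqVneq g 0.
- by move=> _; exists 0%N; rewrite f0 g0; field; rewrite a b.
- rewrite f0 => e; have e' : g / t = - k%:R.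
    by rewrite -e -[t *+ 2]mulr_natl; field; rewrite a b.
  case: k e' {e} => [|k] e'; first by move/eqP: e'; rewrite oppr0 mulf_eq0 invr_eq0 (negbTE g0) (negbTE b).
  exists k; transitivity (g / t + 1); first by rewrite -[s *+ 2]mulr_natl; field; rewrite a b.
  by rewrite e' -natr1; ring.
- rewrite g0 => e; have e' : f / s + 1 = - k%:R.
    by rewrite -e -[t *+ 2]mulr_natl; field; rewrite a b.
  exists k.+1; rewrite -[s *+ 2]mulr_natl -[k.+1%:R]natr1 opprD -e'; field; by rewrite a b.
- move=> e; exists k; rewrite -e -[s *+ 2]mulr_natl -[t *+ 2]mulr_natl.
  by field; rewrite a b.
Qed.

(* Both reflexions stay possible all along the orbit of [u] under the reflexions
   at [x] and [y]: see [dihedral_reflexion]. *)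
Definition dihedral u x y : Prop :=
  [/\ y != x, linked u x y, reflectable u x /\ reflectable u y,
      reflectable (reflexion u x) y & reflectable (reflexion u y) x].

Lemma dihedralC u x y : dihedral u x y -> dihedral u y x.
Proof. by case=> n l [rx ry] ryx rxy; split; rewrite // 1?eq_sym // linkedC. Qed.

(** Only the reflectability of $x$ at $r_yr_xu$ is at stake. If one of the two steps is anisotropic,
    this datum has the Cartan datum of $r_xu$ or of $r_yu$; if both are isotropic,
    [isotropic_pair_reflectable] applies at $r_xu$. *)
Lemma dihedral_reflexion u x y : dihedral u x y -> dihedral (reflexion u x) y x.
Proof.
case=> n l [rx ry] ryx rxy; split; rewrite ?reflexionK //.
- by rewrite eq_sym.
- by rewrite linkedC linked_reflexion.
- by split=> //; exact: reflectable_reflexion.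
have same t : same_cartan (reflexion (reflexion u x) y) t -> reflectable t x ->
  reflectable (reflexion (reflexion u x) y) x by exact: same_cartan_reflectable.
have [Ey|Ny] := eqVneq (cartan (reflexion u x) y y) 0; last first.
  by apply: (same _ (same_cartan_anisotropic Ny)); exact: reflectable_reflexion.
have [Ex|Nx] := eqVneq (cartan u x x) 0; last first.
  apply: (same (reflexion u y)) => //.
  exact/same_cartan_reflexion/same_cartan_anisotropic.
apply: isotropic_pair_reflectable; rewrite ?reflexionK //.
- exact: linked_reflexion.
- exact: reflectable_reflexion.
- by rewrite reflexion_cartan_x Ex eqxx oppr0.
Qed.

(* In the mixed case, two natural numbers [l] and [l / (l - 1)] force [l = 2]. *)
Lemma dihedral_isotropic u x y : dihedral u x y -> cartan u x x = 0 ->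
  [/\ db u x y = 1, db (reflexion u x) y x = db u y x &
   [\/ cartan u y y = 0 /\ db u y x = 1,
       [/\ cartan u y y != 0, cartan (reflexion u x) y y = 0 & db u y x = 1] |
       [/\ cartan u y y != 0, cartan (reflexion u x) y y != 0 & db u y x = 2]]].
Proof.
case=> n l [rx ry] ryx rxy E; have [a b] := andP l.
have nxy : x != y by rewrite eq_sym.
have A := reflexion_cartan_isotropic n E a.
have B : cartan (reflexion u x) y x = - cartan u y x by rewrite reflexion_cartan_xr.
have d1 : db u x y = 1 by rewrite /db E eqxx (negbTE n) (negbTE a).
have [Ey|Ny] := eqVneq (cartan u y y) 0.
  have dy : db u y x = 1 by rewrite /db Ey eqxx (negbTE nxy) (negbTE b).
  have N : cartan u y x *+ 2 != 0 by rewrite -mulr_natl mulf_neq0 ?pnatr_eq0.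
  have -> : db (reflexion u x) y x = 1.
    rewrite /db A B Ey add0r N /= mulrN mulNr opprK mulr_natl divff //.
  by split=> //; apply: Or31.
have [k ek _] := reflectable_anisotropic ry Ny nxy.
have dk : db u y x = k%:R.
  by rewrite /db Ny mulr_natl ek mulNr opprK -[_ y y *+ k]mulr_natl mulfK.
have A' : cartan (reflexion u x) y y = cartan u y y * (1 - k%:R).
  by rewrite A ek mulrBr mulr1 mulr_natr.
have [Ey'|Ny'] := eqVneq (cartan (reflexion u x) y y) 0.
  have k1 : k%:R = 1 :> K.
    by move/eqP: Ey'; rewrite A' mulf_eq0 (negbTE Ny) subr_eq0 /= => /eqP.
  have -> : db (reflexion u x) y x = 1.
    by rewrite /db Ey' eqxx (negbTE nxy) B oppr_eq0 (negbTE b).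
  by rewrite dk k1; split=> //; apply: Or32.
have [k' ek' _] := reflectable_anisotropic ryx Ny' nxy.
have dk' : db (reflexion u x) y x = k'%:R.
  rewrite /db Ny' mulr_natl ek' mulNr opprK -[_ y y *+ k']mulr_natl mulfK //.
have : k%:R = k'%:R * (k%:R - 1) :> K.
  apply: (mulfI Ny); move: ek'; rewrite B A' mulNrn ek opprK => ek'.
  by rewrite mulr_natr ek' -[in LHS]mulr_natr; ring.
have b' : k != 0%N.
  by apply: contraNneq (db_neq0 nxy b) => k0; rewrite dk k0.
case: k b' {ek A'} dk => // k _ dk; rewrite -natr1 addrK -natrM natr1 => /eqP.
rewrite eqr_nat => /eqP kk'.
(* Here [k] has been lowered by one, so that the equation reads $k+1=k'k$. *)
have [k1 k'2] : k = 1%N /\ k' = 2%N.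
  by case: k k' kk' {dk ek' dk'} => [|[|k]] [|[|k']] kk'; split; nia.
rewrite dk' dk k1 k'2; split=> //; apply: Or33; split=> //.
Qed.

(** Thanks to this invariance one pair of coefficients governs a whole alternating walk. *)
Lemma db_dihedral_reflexion u x y : dihedral u x y ->
  db (reflexion u x) x y = db u x y /\ db (reflexion u x) y x = db u y x.
Proof.
move=> d; have [n l _ _ _] := d; have [a b] := andP l.
have [E|N] := eqVneq (cartan u x x) 0; last first.
  by have s := same_cartan_anisotropic N; rewrite !(db_same_cartan _ _ s).
have [-> -> _] := dihedral_isotropic d E; split=> //.
by rewrite /db !reflexion_cartan_x E eqxx oppr0 eqxx (negbTE n) oppr_eq0 (negbTE a).
Qed.

Lemma da_dihedral_reflexion u x y : dihedral u x y ->
  da (reflexion u x) x y = da u x y /\ da (reflexion u x) y x = da u y x.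
Proof.
move=> d; have [n l _ _ _] := d; have [a b] := andP l.
have [a' b'] := andP (linked_reflexion n l).
rewrite !da_db //; have [-> ->] := db_dihedral_reflexion d.
rewrite reflexion_cartan_x reflexion_cartan_col //.
by case: ifP => // _; rewrite invrN invrN !mulrNN.
Qed.

Lemma da_dihedral_mul u x y : dihedral u x y ->
  da u x y * da u y x = db u x y * db u y x.
Proof.
case=> n /andP[a b] _ _ _; rewrite !da_db //.
by field; rewrite a b.
Qed.

(** If $x$ or $y$ is isotropic, the determinant is $-a_{xy}a_{yx}\ne0$. Otherwise the product of
    coefficients is $4a_{xy}a_{yx}/(a_{xx}a_{yy})$, which equals $4$ when the determinant
    vanishes. *)
Lemma dihedral_det u x y : dihedral u x y -> db u x y * db u y x != 4 ->
  cartan u x x * cartan u y y - cartan u x y * cartan u y x != 0.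
Proof.
move=> d n4; have [n l [rx ry] _ _] := d; have [a b] := andP l.
have [E|Nx] := eqVneq (cartan u x x) 0.
  by rewrite E mul0r sub0r oppr_eq0 mulf_neq0.
have [E|Ny] := eqVneq (cartan u y y) 0.
  by rewrite E mulr0 sub0r oppr_eq0 mulf_neq0.
apply: contraNneq n4 => e.
rewrite /db Nx Ny; apply/eqP.
have -> : - (2 * cartan u x y / cartan u x x) * - (2 * cartan u y x / cartan u y y) =
  4 * (cartan u x y * cartan u y x) / (cartan u x x * cartan u y y).
  by field; rewrite Nx Ny.
move/eqP: e; rewrite subr_eq0 => /eqP <-.
by field; rewrite Nx Ny.
Qed.

End Dihedral.

(** * Alternating words and their matrices *)

Section AlternatingWalks.

Fixpoint alt (T : Type) (x y : T) (n : nat) : seq T :=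
  if n is m.+1 then x :: alt y x m else [::].

Lemma size_alt T (x y : T) n : size (alt x y n) = n.
Proof. by elim: n x y => //= n IH x y; rewrite IH. Qed.

Lemma alt_cat T (x y : T) m n :
  alt x y (m + n) = alt x y m ++ (if odd m then alt y x n else alt x y n).
Proof. by elim: m x y => //= m IH x y; rewrite IH; case: (odd m). Qed.

(* If the reflexions at [x] and [y] act on a pair of vectors by
   [(a, b) |-> (- a, b + k a)] and [(a, b) |-> (a + l b, - b)], then after [n]
   of them, [x] first, the pair is [(p a + q b, r a + s b)] where
   [((p, q), (r, s)) = braid k l n]. *)
Fixpoint braid (R : pzRingType) (k l : R) (n : nat) : (R * R) * (R * R) :=
  if n is m.+1 then
    let: ((p, q), (r, s)) := braid l k m in ((k * r - s, r), (k * p - q, p))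
  else ((1, 0), (0, 1)).

(** The Coxeter exponents for products $1$, $2$, $3$ of the coefficients; the default value stands
    for $c=3$. *)
Definition braid_length (c : nat) : nat :=
  match c with 1 => 3 | 2 => 4 | _ => 6 end.

(** Substituting $l=c/k$ leaves three explicit matrix identities in $k$. They say that the two
    alternating walks agree at both letters. *)
Lemma braid_swap (K : fieldType) (k l : K) (c : nat) : (0 < c < 4)%N ->
  k * l = c%:R -> k != 0 ->
  let: ((p, q), (r, s)) := braid k l (braid_length c) in
  braid l k (braid_length c) = ((s, r), (q, p)).
Proof.
move=> c4 e k0; have -> : l = c%:R / k by rewrite -e mulrAC mulfV ?mul1r.
case: c c4 {e} => [|[|[|[|]]]] //= _; congr (_, _, (_, _)); by field.
Qed.

End AlternatingWalks.

(** * Endpoints of alternating walks: the two letters and the Cartan datum *)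

Section DihedralWalks.
Variables (K : numFieldType) (X : finType) (h : vectType K).
Implicit Types u v w : rootDatum X h.

Lemma shear_comb (V : lmodType K) (k p q : K) (a b : V) :
  p *: (b + k *: a) + q *: - a = (k * p - q) *: a + p *: b.
Proof. by rewrite scalerDr scalerN scalerA scalerBl [k * p]mulrC -addrA addrC. Qed.

Lemma dihedral_is_walk u x y n : dihedral u x y -> is_walk u (alt x y n).
Proof.
elim: n u x y => //= n IH u x y d; split; first by case: d => _ _ [].
exact/IH/dihedral_reflexion.
Qed.

Lemma dihedral_walk u x y n : dihedral u x y -> dihedral (walk u (alt x y n)) x y.
Proof.
elim: n u x y => //= n IH u x y d.
exact/dihedralC/IH/dihedral_reflexion.
Qed.

Lemma dihedral_walk_b u x y n : dihedral u x y ->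
  let: ((p, q), (r, s)) := braid (db u x y) (db u y x) n in
  rd_b (walk u (alt x y n)) x = p *: rd_b u x + q *: rd_b u y /\
  rd_b (walk u (alt x y n)) y = r *: rd_b u x + s *: rd_b u y.
Proof.
elim: n u x y => [|n IH] u x y d; first by rewrite /= !scale1r !scale0r addr0 add0r.
have := IH _ _ _ (dihedral_reflexion d); have [-> ->] := db_dihedral_reflexion d.
rewrite /=; case: (braid _ _ n) => [[p q] [r s]] [-> ->].
have [nyx _ _ _ _] := d; rewrite reflexion_b_x rd_b_reflexion //.
by rewrite !shear_comb.
Qed.

Lemma dihedral_walk_a u x y n : dihedral u x y ->
  let: ((p, q), (r, s)) := braid (da u x y) (da u y x) n in
  rd_a (walk u (alt x y n)) x = p *: rd_a u x + q *: rd_a u y /\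
  rd_a (walk u (alt x y n)) y = r *: rd_a u x + s *: rd_a u y.
Proof.
elim: n u x y => [|n IH] u x y d; first by rewrite /= !scale1r !scale0r addr0 add0r.
have := IH _ _ _ (dihedral_reflexion d); have [-> ->] := da_dihedral_reflexion d.
rewrite /=; case: (braid _ _ n) => [[p q] [r s]] [-> ->].
have [nyx _ _ _ _] := d; rewrite reflexion_a_x rd_a_reflexion //.
by rewrite !shear_comb.
Qed.

(** Only isotropic steps move the Cartan datum. When $x$ is isotropic, [dihedral_isotropic] leaves
    three configurations, with $c=1,1,2$: in the first and third both walks return to the Cartan
    datum of $u$, in the second both end at that of $r_yr_xu$. *)
Lemma dihedral_same_cartan u x y (c : nat) : dihedral u x y -> (0 < c < 4)%N ->
  db u x y * db u y x = c%:R ->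
  same_cartan (walk u (alt x y (braid_length c))) (walk u (alt y x (braid_length c))).
Proof.
have refl := @same_cartan_refl K X h; have sym := @same_cartan_sym K X h.
have tr := @same_cartan_trans K X h.
have step w w' z : cartan w' z z != 0 -> same_cartan w w' -> same_cartan (reflexion w z) w'.
  by move=> N s; exact: tr (same_cartan_reflexion z s) (same_cartan_anisotropic N).
have back w w' z : same_cartan w (reflexion w' z) -> same_cartan (reflexion w z) w'.
  by move=> /(same_cartan_reflexion z); rewrite reflexionK.
have isotropic x' y' : dihedral u x' y' -> cartan u x' x' = 0 ->
    db u x' y' * db u y' x' = c%:R ->
  same_cartan (walk u (alt x' y' (braid_length c))) (walk u (alt y' x' (braid_length c))).
  move: x' y' => {}x {}y d E; have [-> _] := dihedral_isotropic d E.
  have [n l _ _ _] := d; have nxy : x != y by rewrite eq_sym.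
  have [a b] := andP l; have A := reflexion_cartan_isotropic n E a.
  have Ex' : cartan (reflexion u x) x x = 0 by rewrite reflexion_cartan_x E eqxx oppr0.
  case=> [[Ey ->]|[Ny Ey' ->]|[Ny Ny' ->]]; rewrite mul1r => /eqP; rewrite eq_sym ?pnatr_eq1 ?eqr_nat.
  - move=> /eqP-> /=; apply: (@tr _ u); last apply: sym.
      apply/back/step/refl.
      by rewrite A Ey add0r -mulr_natl mulf_neq0 ?pnatr_eq0.
    apply/back/step/refl; rewrite reflexion_cartan_isotropic // E add0r.
    by rewrite -mulr_natl mulf_neq0 ?pnatr_eq0.
  - move=> /eqP-> /=; set w := reflexion u x in Ex' Ey' *.
    apply: (@tr _ (reflexion w y)); last apply: sym.
      apply: step (refl _); rewrite reflexion_cartan_isotropic //.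
        by rewrite Ex' add0r -mulr_natl mulf_neq0 ?pnatr_eq0 //; case/andP: (linked_reflexion n l).
      by case/andP: (linked_reflexion n l).
    apply/same_cartan_reflexion/same_cartan_reflexion.
    exact: same_cartan_anisotropic.
  - move=> /eqP-> /=; apply: (@tr _ u); last apply: sym.
      apply/step => //; apply/back/step/refl => //.
    apply/back; apply: step => //; apply: same_cartan_reflexion.
    exact: same_cartan_anisotropic.
move=> d c4 e; have [Ex|Nx] := eqVneq (cartan u x x) 0; first exact: isotropic.
have [Ey|Ny] := eqVneq (cartan u y y) 0.
  by apply: sym; apply: isotropic; rewrite 1?mulrC //; exact: dihedralC.
have stay n x' y' : cartan u x' x' != 0 -> cartan u y' y' != 0 ->
    forall w, same_cartan w u -> same_cartan (walk w (alt x' y' n)) u.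
  by elim: n x' y' => //= n IH x' y' Nx' Ny' w s; apply: IH => //; exact: step.
exact: tr (stay _ _ _ Nx Ny _ (refl u)) (sym _ _ (stay _ _ _ Ny Nx _ (refl u))).
Qed.

End DihedralWalks.

(** * The plane spanned at two letters, for [rd_a] and [rd_b] alike *)

Section PlaneShear.
Variables (K : numFieldType) (X : finType) (h V : vectType K).
Variable f : rootDatum X h -> {ffun X -> V}.
Hypothesis fx : forall u x, f (reflexion u x) x = - f u x.
Hypothesis fy : forall u x y, y != x -> exists c, f (reflexion u x) y = f u y + c *: f u x.
Implicit Types u : rootDatum X h.

Definition plane u x y : {vspace V} := (<[f u x]> + <[f u y]>)%VS.

Lemma planeC u x y : plane u x y = plane u y x.
Proof. exact: addvC. Qed.

Lemma plane_l u x y : f u x \in plane u x y.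
Proof. by apply: (subvP (addvSl _ _)); exact: memv_line. Qed.

Lemma plane_reflexion u x y : y != x -> plane (reflexion u x) x y = plane u x y.
Proof.
move=> n; have sub w : (plane (reflexion w x) x y <= plane w x y)%VS.
  rewrite subv_add -!memvE fx rpredN plane_l /=.
  have [c ->] := fy w n.
  by rewrite rpredD ?rpredZ ?plane_l // planeC plane_l.
by apply/eqP; rewrite eqEsubv sub -{1}(reflexionK u x) sub.
Qed.

Lemma plane_walk u x y n : y != x -> plane (walk u (alt x y n)) x y = plane u x y.
Proof.
elim: n u x y => //= n IH u x y nyx.
by rewrite planeC IH 1?eq_sym // planeC plane_reflexion.
Qed.

Lemma walk_plane u x y z n : y != x -> z != x -> z != y ->
  f (walk u (alt x y n)) z - f u z \in plane u x y.
Proof.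
elim: n u x y => [|n IH] u x y nyx nzx nzy /=; first by rewrite subrr rpred0.
have [c e] := fy u nzx; have nxy : x != y by rewrite eq_sym.
have := IH (reflexion u x) y x nxy nzy nzx; rewrite planeC plane_reflexion // e opprD addrA.
by move/rpredD=> /(_ _ (rpredZ c (plane_l u x y))); rewrite subrK.
Qed.

End PlaneShear.

(** * Braid relations for linked letters *)

Section BraidRelation.
Variables (K : numFieldType) (X : finType) (h : vectType K).
Implicit Types u v w : rootDatum X h.

Lemma det2_eq0 (a b c d i j : K) : a * d - b * c != 0 ->
  i * a + j * b = 0 -> i * c + j * d = 0 -> i = 0 /\ j = 0.
Proof.
move=> N e1 e2; split; apply: (mulIf N); rewrite mul0r.
  transitivity ((i * a + j * b) * d - (i * c + j * d) * b); first by ring.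
  by rewrite e1 e2; ring.
transitivity ((i * c + j * d) * a - (i * a + j * b) * c); first by ring.
by rewrite e1 e2; ring.
Qed.

(* Two data with the same Cartan datum that agree at [x] and [y] and whose
   vectors at [z] differ by elements of the plane agree at [z]: the difference
   is orthogonal to a plane on which the pairing is nondegenerate. *)
Lemma rootDatum_eq_plane u w x y : y != x -> same_cartan u w ->
  cartan u x x * cartan u y y - cartan u x y * cartan u y x != 0 ->
  rd_a u x = rd_a w x -> rd_a u y = rd_a w y ->
  rd_b u x = rd_b w x -> rd_b u y = rd_b w y ->
  (forall z, z != x -> z != y -> rd_a u z - rd_a w z \in plane (@rd_a K X h) u x y) ->
  (forall z, z != x -> z != y -> rd_b u z - rd_b w z \in plane (@rd_b K X h) u x y) ->
  u = w.
Proof.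
move=> nyx [p A] N ax ay bx by_ pa pb.
apply: rootDatum_eq => //; apply/ffunP => z.
  have [->//|nzx] := eqVneq z x; have [->//|nzy] := eqVneq z y.
  have /memv_addP[_ /vlineP[i ->] [_ /vlineP[j ->] e]] := pa z nzx nzy.
  have e' t : rd_b u t = rd_b w t -> i * cartan u x t + j * cartan u y t = 0.
    move=> et; have := congr1 (rd_b u t) e; rewrite linearB {2}et /=.
    by rewrite -/(cartan u z t) -/(cartan w z t) A subrr linearD !linearZ /=.
  apply/eqP; rewrite -subr_eq0 e.
  have [-> ->] : i = 0 /\ j = 0.
    apply: det2_eq0 (e' x bx) (e' y by_).
    by rewrite [cartan u y x * _]mulrC.
  by rewrite !scale0r addr0.
have [->//|nzx] := eqVneq z x; have [->//|nzy] := eqVneq z y.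
have /memv_addP[_ /vlineP[i ->] [_ /vlineP[j ->] e]] := pb z nzx nzy.
have e' t : rd_a u t = rd_a w t -> i * cartan u t x + j * cartan u t y = 0.
  move=> et; have := congr1 (fun g : dual h => g (rd_a u t)) e.
  rewrite !lfunE /= opp_lfunE {2}et.
  by rewrite -/(cartan u t z) -/(cartan w t z) A subrr !scale_lfunE.
apply/eqP; rewrite -subr_eq0 e.
have [-> ->] : i = 0 /\ j = 0 by exact: det2_eq0 (e' x ax) (e' y ay).
by rewrite !scale0r addr0.
Qed.

(** The endpoints agree at $x$ and $y$ by [braid_swap], used for [db] and for [da], whose products
    coincide. Elsewhere they differ by vectors of the plane, on which the pairing is nondegenerate
    since $c\ne4$. *)
Lemma dihedral_braid u x y (c : nat) : dihedral u x y -> (0 < c < 4)%N ->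
  db u x y * db u y x = c%:R ->
  walk u (alt x y (braid_length c)) = walk u (alt y x (braid_length c)).
Proof.
move=> d c4 e; have [nyx l _ _ _] := d; have [a b] := andP l.
have nxy : x != y by rewrite eq_sym.
set m := braid_length c.
have S := dihedral_same_cartan d c4 e.
have b0 := db_neq0 nyx a.
have a0 : da u x y != 0 by rewrite da_db // !mulf_neq0 ?invr_eq0.
have := dihedral_walk_b m d; have := dihedral_walk_b m (dihedralC d).
have := dihedral_walk_a m d; have := dihedral_walk_a m (dihedralC d).
have := braid_swap c4 e b0; rewrite -(da_dihedral_mul d) in e.
have := braid_swap c4 e a0; rewrite -/m.
case: (braid (da u x y) (da u y x) m) => [[p q] [r s]] ->.
case: (braid (db u x y) (db u y x) m) => [[p' q'] [r' s']] ->.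
case=> ay' ax' [ax ay] [by' bx'] [bx by_].
apply: (rootDatum_eq_plane nyx S).
- have dm := dihedral_walk m d; apply: (dihedral_det dm).
  have D : db (walk u (alt x y m)) x y * db (walk u (alt x y m)) y x = c%:R.
    rewrite (da_dihedral_mul d) in e; rewrite -e.
    elim: (m) (x) (y) (u) d => //= k IH x' y' w dw.
    rewrite mulrC IH; last exact: dihedral_reflexion.
    by have [-> ->] := db_dihedral_reflexion dw; rewrite mulrC.
  by rewrite D (eqr_nat K c 4) neq_ltn; case/andP: c4 => _ ->.
- by rewrite ax ax' addrC.
- by rewrite ay ay' addrC.
- by rewrite bx bx' addrC.
- by rewrite by_ by' addrC.
- move=> z nzx nzy; have fx := @reflexion_a_x K X h; have fy := @reflexion_a_y K X h.
  rewrite plane_walk //; have := walk_plane fx fy u m nyx nzx nzy.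
  have := walk_plane fx fy u m nxy nzy nzx; rewrite planeC => h1 h2.
  by have := rpredB h2 h1; rewrite opprB addrA subrK.
- move=> z nzx nzy; have fx := @reflexion_b_x K X h; have fy := @reflexion_b_y K X h.
  rewrite plane_walk //; have := walk_plane fx fy u m nyx nzx nzy.
  have := walk_plane fx fy u m nxy nzy nzx; rewrite planeC => h1 h2.
  by have := rpredB h2 h1; rewrite opprB addrA subrK.
Qed.

End BraidRelation.

(** * The exchange condition for dihedral pairs *)

Section RankTwo.
Variables (K : numFieldType) (X : finType) (h : vectType K).
Implicit Types u v w : rootDatum X h.

Definition alt_next (x y : X) (n : nat) : X := if odd n then y else x.

Lemma alt_rcons x y n : alt x y n.+1 = alt x y n ++ [:: alt_next x y n].
Proof. by rewrite -addn1 alt_cat /alt_next; case: (odd n). Qed.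

Definition in_cone u x y (beta : dual h) : Prop :=
  exists i j : nat, beta = rd_b u x *+ i + rd_b u y *+ j.

Definition reached_before u w n : Prop :=
  exists s, [/\ is_walk u s, (size s < n)%N & walk u s = w].

(* What the exchange condition of Coxeter groups becomes for the alternating
   walk of length [n] from [u], starting with [x]. *)
Definition exchange u x y n : Prop :=
  let w := walk u (alt x y n) in let t := alt_next x y n in
  [\/ in_cone u x y (rd_b w t),
      reflectable w t /\ reached_before u (reflexion w t) n |
      reached_before u w n].

(** The next letter of the walk from $x$ after $m$ steps is the last letter of the walk from $y$ of
    length $m$. For $n=m$, reflecting there undoes that last step; for $n>m$, the walk itself undoes
    it and can be shortened by two. *)
Lemma exchange_braid u x y m n : (0 < m <= n)%N ->
  walk u (alt x y m) = walk u (alt y x m) -> is_walk u (alt y x m) ->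
  is_walk u (alt x y n) -> exchange u x y n.
Proof.
case: m => // m /andP[_ lemn]; rewrite (alt_rcons y x m) walk_cat => e.
case/is_walk_cat=> ws [/= r _] wn.
have nx : alt_next x y m.+1 = alt_next y x m by rewrite /alt_next /=; case: (odd m).
have [lt|le|eq] := ltngtP m.+1 n; last 2 first.
- by rewrite ltnNge lemn in le.
- apply: Or32; rewrite -eq nx e; split; first exact: reflectable_reflexion.
  by exists (alt y x m); rewrite size_alt reflexionK.
move: wn; rewrite -(subnKC lt); move: (n - _)%N => j wn {n lemn lt}.
apply: Or33; rewrite alt_cat alt_rcons nx !walk_cat e /= reflexionK.
move: wn; rewrite alt_cat alt_rcons nx => /is_walk_cat[_].
rewrite walk_cat e /= reflexionK.
set rest := (X in is_walk _ X) => wr.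
have sr : size rest = j by rewrite /rest; case: ifP; rewrite size_alt.
exists (alt y x m ++ rest); rewrite walk_cat size_cat sr size_alt.
by split=> //; apply/is_walk_cat.
Qed.

(** The row of [braid] belonging to the next letter of the walk, over the integers so that signs can
    be compared. *)
Fixpoint next_root (k l : int) (n : nat) : int * int :=
  if n is m.+1 then let: (p, q) := next_root l k m in (k * p - q, p) else (1, 0).

Lemma dihedral_next_root u x y (k l : int) n : dihedral u x y ->
  db u x y = k%:~R -> db u y x = l%:~R ->
  let: (p, q) := next_root k l n in
  rd_b (walk u (alt x y n)) (alt_next x y n) = p%:~R *: rd_b u x + q%:~R *: rd_b u y.
Proof.
elim: n u x y k l => [|n IH] u x y k l d ek el.
  by rewrite /= scale1r scale0r addr0.
have [ek' el'] := db_dihedral_reflexion d; rewrite ek in ek'; rewrite el in el'.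
have := IH _ _ _ _ _ (dihedral_reflexion d) el' ek'.
rewrite /= /alt_next /=; case: (next_root l k n) => p q; rewrite if_neg => ->.
have [nyx _ _ _ _] := d.
by rewrite reflexion_b_x rd_b_reflexion // ek shear_comb rmorphB rmorphM.
Qed.

(** The bound $kq\le2p$ strengthens the induction: from $lq\le2p$ one gets $4q\le klq\le2kp$, hence
    $2q\le kp$, which gives both the sign of $kp-q$ and the next bound. *)
Lemma next_root_affine (k l : int) n : 1 <= k -> 1 <= l -> 4 <= k * l ->
  let: (p, q) := next_root k l n in [/\ 0 <= p, 0 <= q & k * q <= 2 * p].
Proof.
elim: n k l => [|n IH] k l k1 l1 kl /=; first by rewrite mulr0; split.
have := IH _ _ l1 k1; rewrite [l * k]mulrC => /(_ kl); case: (next_root l k n) => p q [p0 q0 lq].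
have kp : 2 * q <= k * p.
  have : 4 * q <= k * l * q by rewrite ler_wpM2r.
  have : k * (l * q) <= k * (2 * p) by rewrite ler_wpM2l //; lia.
  by rewrite mulrA mulrCA; lia.
by split=> //; lia.
Qed.

Lemma next_root_finite (k l : nat) n : (0 < k * l < 4)%N -> (n < braid_length (k * l))%N ->
  let: (p, q) := next_root k%:Z l%:Z n in 0 <= p /\ 0 <= q.
Proof.
case/andP=> kl0 kl; have /andP[k0 l0] : (0 < k)%N && (0 < l)%N by rewrite -muln_gt0.
have k4 := leq_ltn_trans (leq_pmulr k l0) kl.
have l4 := leq_ltn_trans (leq_pmull l k0) kl.
by case: k l kl kl0 k0 l0 k4 l4 => [|[|[|[|k]]]] [|[|[|[|l]]]] // _ _ _ _ _ _;
  case: n => [|[|[|[|[|[|n]]]]]].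
Qed.

Lemma in_cone_int u x y (p q : int) : 0 <= p -> 0 <= q ->
  in_cone u x y (p%:~R *: rd_b u x + q%:~R *: rd_b u y).
Proof.
by case: p q => [p|p] [q|q] // _ _; exists p, q; rewrite !scaler_nat.
Qed.

Lemma dihedral_exchange u x y n : dihedral u x y -> exchange u x y n.
Proof.
move=> d; have [nyx l [rx ry] _ _] := d; have [a b] := andP l.
have nxy : x != y by rewrite eq_sym.
have [k ek] := db_nat rx nyx; have [m em] := db_nat ry nxy.
have k0 : (0 < k)%N by move: (db_neq0 nyx a); rewrite ek pnatr_eq0 lt0n.
have m0 : (0 < m)%N by move: (db_neq0 nxy b); rewrite em pnatr_eq0 lt0n.
have R := @dihedral_next_root u x y k%:Z m%:Z n d ek em.
have [fin|inf] := ltnP (k * m) 4; last first.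
  have := @next_root_affine k%:Z m%:Z n; case: (next_root _ _ n) R => p q R.
  case; [lia|lia|lia|] => p0 q0 _.
  by apply: Or31; rewrite R; exact: in_cone_int.
have c4 : (0 < k * m < 4)%N by rewrite muln_gt0 k0 m0.
have [lt|le] := ltnP n (braid_length (k * m)).
  have := next_root_finite c4 lt; case: (next_root _ _ n) R => p q R [p0 q0].
  by apply: Or31; rewrite R; exact: in_cone_int.
apply: (@exchange_braid _ _ _ (braid_length (k * m))).
- by rewrite le andbT; case: (k * m)%N => [|[|[|]]].
- by apply: dihedral_braid => //; rewrite ek em natrM.
- exact/dihedral_is_walk/dihedralC.
- exact: dihedral_is_walk.
Qed.

(** * Orthogonal letters and the braid relation of length two *)

Section Orthogonal.
Variables (u : rootDatum X h) (x y : X).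
Hypotheses (nyx : y != x) (a : cartan u x y = 0) (b : cartan u y x = 0).

Lemma orthogonal_db : db u x y = 0.
Proof. by rewrite /db (negbTE nyx) a eqxx mulr0 mul0r oppr0 if_same. Qed.

Lemma orthogonal_da : da u x y = 0.
Proof. by rewrite /da (negbTE nyx) a b eqxx mulr0 mul0r oppr0 if_same. Qed.

Lemma orthogonal_p : rd_p (reflexion u x) y = rd_p u y.
Proof. by rewrite ffunE (negbTE nyx) a eqxx if_same. Qed.

Lemma orthogonal_row z : cartan (reflexion u x) y z = cartan u y z.
Proof.
rewrite reflexion_cartan orthogonal_da b /ca (negbTE nyx) andbF !mul0r mulr0 !addr0 mul1r mulr0 addr0.
by case: (eqVneq z x) => [->|_]; rewrite ?andbF ?mul1r // b mulr0.
Qed.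

Lemma orthogonal_col z : cartan (reflexion u x) z y = cartan u z y.
Proof.
rewrite reflexion_cartan orthogonal_db a /ca (negbTE nyx) andbF mul0r mulr0 !addr0 mul1r.
by case: (eqVneq z x) => [->|_]; rewrite ?andbF ?mul1r // a mulr0.
Qed.

Lemma orthogonal_reflectable : reflectable (reflexion u x) y <-> reflectable u y.
Proof.
rewrite /reflectable orthogonal_p orthogonal_row; split; case.
- by move=> ?; apply: Or31.
- by case=> ? ? H; apply: Or32; split=> // z /H; rewrite orthogonal_row.
- by case=> ? ? H; apply: Or33; split=> // z /H; rewrite orthogonal_row.
- by move=> ?; apply: Or31.
- by case=> ? ? H; apply: Or32; split=> // z /H; rewrite orthogonal_row.
- by case=> ? ? H; apply: Or33; split=> // z /H; rewrite orthogonal_row.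
Qed.

End Orthogonal.

Lemma orthogonal_commute u x y : y != x -> cartan u x y = 0 -> cartan u y x = 0 ->
  reflexion (reflexion u x) y = reflexion (reflexion u y) x.
Proof.
move=> nyx a b; have nxy : x != y by rewrite eq_sym.
(* The factor [ca w y' z] can differ from $1$ only at $z=y'$, where the coefficients of $x'$
   vanish. *)
have ca_da w x' y' z : y' != x' -> cartan w x' y' = 0 -> cartan w y' x' = 0 ->
    ca w y' z * da w x' z = da w x' z /\ ca w y' z * db w x' z = db w x' z.
  move=> n a' b'; rewrite /ca; case: (eqVneq z y') => [->|_]; last by rewrite andbF !mul1r.
  by rewrite orthogonal_da // orthogonal_db // !mulr0.
have cad w x' y' z : y' != x' -> cartan w x' y' = 0 -> cartan w y' x' = 0 ->
    [/\ ca (reflexion w x') y' z = ca w y' z, da (reflexion w x') y' z = da w y' z &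
        db (reflexion w x') y' z = db w y' z].
  by move=> n a' b'; rewrite /ca /da /db !(orthogonal_row n a' b') ?(orthogonal_col n a').
have [A1 A2 A3] : [/\ forall z, ca (reflexion u x) y z = ca u y z,
   forall z, da (reflexion u x) y z = da u y z & forall z, db (reflexion u x) y z = db u y z].
  by split=> z; case: (cad u x y z nyx a b).
have [B1 B2 B3] : [/\ forall z, ca (reflexion u y) x z = ca u x z,
   forall z, da (reflexion u y) x z = da u x z & forall z, db (reflexion u y) x z = db u x z].
  by split=> z; case: (cad u y x z nxy b a).
apply: rootDatum_eq; apply/ffunP => z.
- rewrite !reflexion_aE A1 A2 B1 B2 (orthogonal_da nyx a b) (orthogonal_da nxy b a).
  rewrite !scale0r !addr0 {3 6}/ca (negbTE nyx) (negbTE nxy) !andbF !scale1r !scalerDr !scalerA.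
  have [-> _] := ca_da u x y z nyx a b; have [-> _] := ca_da u y x z nxy b a.
  by rewrite [ca u y z * _]mulrC addrAC.
- rewrite !reflexion_bE A1 A3 B1 B3 (orthogonal_db nyx a) (orthogonal_db nxy b).
  rewrite !scale0r !addr0 {3 6}/ca (negbTE nyx) (negbTE nxy) !andbF !scale1r !scalerDr !scalerA.
  have [_ ->] := ca_da u x y z nyx a b; have [_ ->] := ca_da u y x z nxy b a.
  by rewrite [ca u y z * _]mulrC addrAC.
- rewrite ![rd_p (reflexion (reflexion _ _) _) _]ffunE !orthogonal_row // !ffunE.
  have [->|nzx] := eqVneq z x; first by rewrite (negbTE nxy) b eqxx !if_same.
  have [->|nzy] := eqVneq z y; first by rewrite (negbTE nyx) a eqxx !if_same.
  by do 4!case: ifP => _ //; rewrite addrAC.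
Qed.

End RankTwo.

(** * The exchange condition for arbitrary pairs of letters *)

Section RankTwoExchange.
Variables (K : numFieldType) (X : finType) (h : vectType K).
Implicit Types u v w : rootDatum X h.

Lemma orthogonal_exchange u x y n : y != x -> cartan u x y = 0 -> cartan u y x = 0 ->
  is_walk u (alt x y n.+2) -> exchange u x y n.+2.
Proof.
move=> nyx a b W; have nxy : x != y by rewrite eq_sym.
have [rx [ryx _]] := W.
have ry : reflectable u y by exact/orthogonal_reflectable/ryx.
have rxy : reflectable (reflexion u y) x by exact/(orthogonal_reflectable nxy b a).
apply: (@exchange_braid _ _ _ _ _ _ 2) => //=.
exact: orthogonal_commute.
Qed.

Lemma Z2_add1_neq1 (c : 'Z_2) : c + 1 != 1 -> c = 1.
Proof.
by case: c => -[|[|m]] i // _; exact: val_inj.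
Qed.

(* If [y] is not reflectable at [u], the walk stops after three steps at most:
   the reflexions at [x], [y], [x] then have coefficients [1], [k], [1] with
   [k >= 2]. *)
Lemma linked_exchange u x y n : y != x -> linked u x y ->
  is_walk u (alt x y n.+3) -> exchange u x y n.+3.
Proof.
move=> nyx l [rx [ryx [rxyx W]]]; have nxy : x != y by rewrite eq_sym.
have l1 := linked_reflexion nyx l; have [a1 b1] := andP l1.
have rx1 := reflectable_reflexion rx.
have [ry|nry] := pselect (reflectable u y).
  have d : dihedral (reflexion u x) x y by split; rewrite ?reflexionK.
  by apply/dihedral_exchange/dihedralC; rewrite -(reflexionK u x); exact: dihedral_reflexion.
(* Were $x$ anisotropic, $y$ would be reflectable at $u$ as it is at $r_xu$. *)
have Ex : cartan u x x = 0.
  apply/eqP; case: eqVneq => // N; case: nry.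
  exact: same_cartan_reflectable (same_cartan_sym (same_cartan_anisotropic N)) ryx.
have Ex1 : cartan (reflexion u x) x x = 0 by rewrite reflexion_cartan_x Ex eqxx oppr0.
have Ny1 : cartan (reflexion u x) y y != 0.
  apply/negP => /eqP Ey1; apply: nry; rewrite -(reflexionK u x).
  by apply: isotropic_pair_reflectable; rewrite // linkedC.
have s := same_cartan_anisotropic Ny1.
have k1 : db u x y = 1 by rewrite /db Ex eqxx (negbTE nyx) (negbTE (proj1 (andP l))).
have k3 : db (reflexion (reflexion u x) y) x y = 1.
  by rewrite (db_same_cartan _ _ s) /db Ex1 eqxx (negbTE nyx) (negbTE a1).
have [k ek odd_k] := reflectable_anisotropic ryx Ny1 nxy.
have k2 : db (reflexion u x) y x = k%:R.
  by rewrite /db Ny1 mulr_natl ek mulNr opprK -[_ y y *+ k]mulr_natl mulfK.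
(* For $k=1$ the letter $y$ would be isotropic at $u$; as $k$ is odd, $y$ would be even at $r_xu$,
   hence odd at $u$, and so reflectable there. *)
have kn1 : k != 1%N.
  apply: contra_notN nry => /eqP k_1; apply: reflectable_isotropic.
    by rewrite -(reflexionK u x) reflexion_cartan_isotropic // ek k_1 subrr.
  have : rd_p (reflexion u x) y != 1 by apply/eqP => /odd_k; rewrite k_1.
  rewrite ffunE Ex eqxx (negbTE nyx) (negbTE (proj1 (andP l))) /=.
  exact: Z2_add1_neq1.
have kn0 : k != 0%N by apply: contraNneq (db_neq0 nxy b1) => k0; rewrite k2 k0.
(* A fourth step would make $y$ reflectable at $r_xr_yr_xu$, which has the Cartan datum of $u$
   because the middle reflexion is anisotropic. *)
case: n W => [_|n [ry3 _]]; last first.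
  case: nry; apply: same_cartan_reflectable ry3.
  rewrite -{1}(reflexionK u x); exact/same_cartan_reflexion/same_cartan_sym.
apply: Or31; rewrite /alt_next /=.
rewrite rd_b_reflexion // k3 reflexion_b_x (rd_b_reflexion _ nxy) k2 reflexion_b_x.
rewrite (rd_b_reflexion _ nyx) k1 !scale1r scaler_nat.
case: k kn0 kn1 {ek odd_k k2} => [|[|k]] // _ _.
(* The root is $(k-2)b_u(x)+(k-1)b_u(y)$ for the original $k$, since lowered by two. *)
exists k, k.+1; rewrite mulrS addrCA addKr mulrS [rd_b u y + _]addrC -addrA addKr.
by rewrite mulrnDl addrCA -mulrS.
Qed.

Lemma rank_two_exchange u x y n : admissible u -> y != x ->
  is_walk u (alt x y n) -> exchange u x y n.
Proof.
move=> adm nyx; have nxy : x != y by rewrite eq_sym.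
case: n => [|[|n]] W.
- by apply: Or31; exists 1%N, 0%N; rewrite /= mulr1n mulr0n addr0.
- case: W => rx _; have [k e] := db_nat rx nyx.
  by apply: Or31; exists k, 1%N; rewrite /= rd_b_reflexion // e scaler_nat addrC.
have [rx [ryx W']] := W.
have [a|a] := eqVneq (cartan u x y) 0.
  by apply: orthogonal_exchange => //; apply: (adm u (Sk_refl u)) a.
have [b|b] := eqVneq (cartan u y x) 0.
  (* Admissibility is applied at $r_xu$, where $y$ is known to be reflectable and both entries are
     those of $u$ up to sign. *)
  have := adm _ (Sk_reflexion rx) _ ryx x.
  rewrite reflexion_cartan_col // reflexion_cartan_x b oppr0 if_same => /(_ erefl)/eqP.
  by case: ifP; rewrite ?oppr_eq0 (negbTE a).
have l : linked u x y by apply/andP.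
case: n W W' => [_ _|n W _]; last exact: linked_exchange.
have [k e] := db_nat rx nyx; have [m e'] := db_nat ryx nxy.
have k0 : (0 < k)%N by move: (db_neq0 nyx a); rewrite e pnatr_eq0 lt0n.
have m0 : (0 < m)%N.
  have := db_neq0 nxy (proj2 (andP (linked_reflexion nyx l))).
  by rewrite e' pnatr_eq0 lt0n.
apply: Or31; exists (m * k).-1, m; rewrite /alt_next /=.
rewrite rd_b_reflexion // e' (rd_b_reflexion _ nyx) e reflexion_b_x !scaler_nat.
rewrite mulrnDl -mulrnA [(k * m)%N]mulnC -[in LHS](@prednK (m * k)) ?muln_gt0 ?m0 //.
by rewrite mulrS addrCA addKr addrC.
Qed.

End RankTwoExchange.

(** * Geodesics and sign coherence of real roots *)

Section Positivity.
Variables (K : numFieldType) (X : finType) (h : vectType K).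
Implicit Types u v w : rootDatum X h.

Definition positive v (beta : dual h) : Prop :=
  exists n : X -> nat, beta = \sum_z rd_b v z *+ n z.

Lemma positive_simple v x : positive v (rd_b v x).
Proof.
exists (fun z => (z == x) : nat); rewrite (bigD1 x) //= eqxx mulr1n big1 ?addr0 //.
by move=> z /negbTE->; rewrite mulr0n.
Qed.

Lemma positive_cone v u x y beta : positive v (rd_b u x) -> positive v (rd_b u y) ->
  in_cone u x y beta -> positive v beta.
Proof.
move=> [n ex] [m ey] [i [j ->]]; rewrite ex ey; exists (fun z => n z * i + m z * j)%N.
by rewrite -!sumrMnl -big_split; apply: eq_bigr => z _; rewrite mulrnDr !mulrnA.
Qed.

Lemma sum_simple_inj v (c d : X -> K) :
  \sum_z c z *: rd_b v z = \sum_z d z *: rd_b v z -> forall x, c x = d x.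
Proof.
have q (k : X -> K) x : fcoord (rd_b v) x (\sum_y k y *: rd_b v y) = k x.
  rewrite /fcoord linear_sum (bigD1 x) //= big1 ?addr0 => [|y nyx];
    rewrite linearZ /= -/(fcoord _ _ _) fcoord_free ?rd_b_free //.
    by rewrite eqxx mulr1.
  by rewrite (negbTE nyx) mulr0.
by move=> e x; rewrite -(q c x) e q.
Qed.

Lemma opp_simple_not_positive v x : ~ positive v (- rd_b v x).
Proof.
case=> n e; have : \sum_z (- (z == x)%:R) *: rd_b v z = \sum_z (n z)%:R *: rd_b v z.
  rewrite -[RHS](eq_bigr _ (fun z _ => esym (scaler_nat _ _))) -e (bigD1 x) //= eqxx scaleN1r.
  by rewrite big1 ?addr0 // => z /negbTE->; rewrite oppr0 scale0r.
move/sum_simple_inj/(_ x)/eqP; rewrite eqxx eq_sym -subr_eq0 opprK natr1.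
by rewrite pnatr_eq0.
Qed.

(** A lower bound on the graph distance; a walk attaining it is a geodesic. *)
Definition distant v w n : Prop :=
  forall s, is_walk v s -> walk v s = w -> (n <= size s)%N.

Lemma geodesic v u : Sk_set v u ->
  exists s, [/\ is_walk v s, walk v s = u & distant v u (size s)].
Proof.
case=> s; have [n le] := ubnP (size s); elim: n s le => // n IH s lt ws es.
have [[t [wt et st]]|far] := pselect (exists t, [/\ is_walk v t, walk v t = u & (size t < size s)%N]).
  exact: IH (leq_trans st lt) wt et.
exists s; split=> // t wt et; rewrite leqNgt; apply/negP => st.
by apply: far; exists t.
Qed.

(** Reflexions being involutive, two equal consecutive letters could be cancelled. *)
Lemma geodesic_alt u x y t : all (fun z => (z == x) || (z == y)) t ->
  is_walk u t -> distant u (walk u t) (size t) ->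
  t = alt x y (size t) \/ t = alt y x (size t).
Proof.
elim: t u => [|z t IH] u /=; first by left.
case/andP=> zxy txy [rz wt] far.
have far' : distant (reflexion u z) (walk (reflexion u z) t) (size t).
  by move=> s ws es; rewrite -ltnS; apply: (far (z :: s)).
have nz t' : t = z :: t' -> False.
  move=> e; move: wt far; rewrite e /= reflexionK => -[_ wt'] /(_ t' wt' erefl).
  by rewrite ltnNge leqnSn.
case/orP: zxy => /eqP ez; subst z.
  case: (IH _ txy wt far'); last by move=> e; left; rewrite {1}e.
  by case: (t) nz => [|z t'] nz /= e; [left | case: (nz _ e)].
case: (IH _ txy wt far'); first by move=> e; right; rewrite {1}e.
by case: (t) nz => [|z t'] nz /= e; [right | case: (nz _ e)].
Qed.

(* The splitting with the longest tail [t'] is the one sought. *)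
Lemma geodesic_split v u x y s t n :
  is_walk v (s ++ t) -> walk v (s ++ t) = u -> size (s ++ t) = n -> distant v u n ->
  (0 < size t)%N -> all (fun z => (z == x) || (z == y)) t ->
  exists s' t', [/\ is_walk v (s' ++ t') /\ walk v (s' ++ t') = u, size (s' ++ t') = n,
    (0 < size t')%N, all (fun z => (z == x) || (z == y)) t' &
    forall z, (z == x) || (z == y) -> reflectable (walk v s') z ->
      distant v (reflexion (walk v s') z) (size s')].
Proof.
move=> + + + far; have [k le] := ubnP (size s); elim: k s t le => // k IH s t lt w e sz t0 txy.
have [done|] := pselect (forall z, (z == x) || (z == y) -> reflectable (walk v s) z ->
      distant v (reflexion (walk v s) z) (size s)); first by exists s, t.
move=> /existsNP[z /not_implyP[zxy /not_implyP[rz /existsNP[r]]]].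
move=> /not_implyP[wr /not_implyP[er /negP]]; rewrite -ltnNge => ltr.
have [ws wt] := (is_walk_cat v s t).1 w.
have w' : is_walk v (r ++ z :: t).
  apply/is_walk_cat; split=> //=; rewrite er reflexionK; split=> //.
  exact: reflectable_reflexion.
have e' : walk v (r ++ z :: t) = u by rewrite walk_cat /= er reflexionK -walk_cat.
apply: (IH r (z :: t)) => //=; last by rewrite zxy.
  exact: leq_trans ltr lt.
apply/eqP; rewrite eqn_leq far // andbT -sz !size_cat /= addnS -addSn.
by rewrite leq_add2r.
Qed.

(** Strong induction on the length. If the walk ends with $y$, it is replaced by a geodesic
    [s' ++ t] whose nonempty tail uses only $x$ and $y$, and where neither letter brings the end
    [u0] of [s'] closer to $v$. By induction both roots at [u0] are positive, and
    [rank_two_exchange] applies to the alternating tail: its other two alternatives contradict the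
    distances. *)
Lemma positivity v u s x : admissible v -> is_walk v s -> walk v s = u ->
  distant v u (size s) -> (reflectable u x -> distant v (reflexion u x) (size s)) ->
  positive v (rd_b u x).
Proof.
move=> adm; have [n le] := ubnP (size s); elim: n s u x le => // n IH s u x.
case: (lastP s) => [|s0 y]; first by move=> _ _ <- _ _; exact: positive_simple.
rewrite size_rcons ltnS -cats1 => lt w e far farx.
have [w0 [/= ry _]] := (is_walk_cat v s0 [:: y]).1 w.
have eu : u = reflexion (walk v s0) y by rewrite -e walk_cat.
have sz : size (s0 ++ [:: y]) = (size s0).+1 by rewrite size_cat addn1.
have xy1 : all (fun z => (z == x) || (z == y)) [:: y] by rewrite /= eqxx orbT.
have nyx : y != x.
  apply/negP => /eqP yx; have := farx; rewrite -yx eu reflexionK.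
  by move/(_ (reflectable_reflexion ry) s0 w0 erefl); rewrite ltnn.
have [s' [t [[wt et] st t0 txy stop]]] := geodesic_split w e sz far (ltn0Sn 0) xy1.
have [ws' wt'] := (is_walk_cat v s' t).1 wt.
set u0 := walk v s' in stop wt'; have eu0 : walk u0 t = u by rewrite -walk_cat.
have fars' : distant v u0 (size s').
  move=> r wr er; have : ((size s0).+1 <= size (r ++ t))%N.
    by apply: far; [apply/is_walk_cat; rewrite er | rewrite walk_cat er].
  by rewrite -st !size_cat leq_add2r.
have lts' : (size s' < n)%N.
  by apply: leq_trans lt; rewrite -st size_cat -addn1 leq_add2l.
have pos z : (z == x) || (z == y) -> positive v (rd_b u0 z).
  by move=> zxy; apply: (IH s') => //; exact: stop.
have fart : distant u0 (walk u0 t) (size t).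
  move=> r wr er; have : ((size s0).+1 <= size (s' ++ r))%N.
    by apply: far; [apply/is_walk_cat | rewrite walk_cat er].
  by rewrite -st !size_cat leq_add2l.
have main a b m : t = alt a b m -> b != a -> m = size t -> alt_next a b m = x ->
    (a == x) || (a == y) -> (b == x) || (b == y) -> positive v (rd_b u x).
  move=> et' nba em ex axy bxy.
  have := @rank_two_exchange _ _ _ u0 a b m (admissible_Sk adm (ex_intro2 _ _ s' ws' erefl)) nba.
  rewrite -et' => /(_ wt'); rewrite /exchange -et' ex eu0.
  case=> [|[rx [r [wr ltr er]]]|[r [wr ltr er]]].
  - by apply: positive_cone; exact: pos.
  - have := farx rx (s' ++ r) ((is_walk_cat _ _ _).2 (conj ws' wr)).
    rewrite walk_cat size_cat -st size_cat leq_add2l => /(_ er).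
    by rewrite -em leqNgt ltr.
  - have := far (s' ++ r) ((is_walk_cat _ _ _).2 (conj ws' wr)).
    rewrite walk_cat size_cat -st size_cat leq_add2l => /(_ er).
    by rewrite -em leqNgt ltr.
(* If the tail ended with $x$, reflecting at $x$ would step back towards $v$, against [farx]. *)
have last a b m : t = alt a b m.+1 -> alt_next a b m = x -> False.
  move=> et' ex; move: wt' eu0; rewrite et' alt_rcons walk_cat ex /= => /is_walk_cat[wr [rx _]] eu0.
  have := farx; rewrite -eu0 reflexionK => /(_ (reflectable_reflexion rx) (s' ++ alt a b m)).
  move/(_ ((is_walk_cat _ _ _).2 (conj ws' wr))); rewrite walk_cat size_cat size_alt.
  have -> : (size s0).+1 = (size s' + m).+1 by rewrite -st size_cat et' size_alt addnS.
  by rewrite ltnn => /(_ erefl).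
have nxy : x != y by rewrite eq_sym.
case em: (size t) t0 (geodesic_alt txy wt' fart) => [//|m] _ [et'|et'].
  have [o|o] := boolP (odd m); first by apply: (main x y m.+1); rewrite ?eqxx ?orbT // /alt_next /= o.
  by case: (last x y m et'); rewrite /alt_next (negbTE o).
have [o|o] := boolP (odd m); first by case: (last y x m et'); rewrite /alt_next o.
by apply: (main y x m.+1); rewrite ?eqxx ?orbT // /alt_next /= o.
Qed.

(** If the reflexion at $x$ does not bring $u$ closer to $v$, [positivity] applies at $u$; otherwise
    it applies at $r_xu$, whose root at $x$ is the opposite one. *)
Lemma sign_coherence v u x : admissible v -> Sk_set v u ->
  positive v (rd_b u x) \/ positive v (- rd_b u x).
Proof.
move=> adm su; have [s [ws es far]] := geodesic su.
have [farx|] := pselect (reflectable u x -> distant v (reflexion u x) (size s)).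
  by left; exact: positivity far farx.
move=> /not_implyP[rx /existsNP[t /not_implyP[wt /not_implyP[et /negP]]]].
rewrite -ltnNge => lt; right; rewrite -reflexion_b_x.
have [r [wr er farr]] := geodesic (ex_intro2 _ _ t wt et : Sk_set v (reflexion u x)).
apply: (positivity adm wr er farr) => _; rewrite reflexionK => q wq eq.
apply: leq_trans (far q wq eq); apply: leq_trans (ltnW lt).
exact: farr.
Qed.

Lemma Sk_eq_of_rd_b v u : admissible v -> Sk_set v u -> rd_b u = rd_b v -> u = v.
Proof.
move=> adm su eb; have [s [ws es far]] := geodesic su.
case: (lastP s) ws es far => [_ <- //|s0 y]; rewrite -cats1 => w e far.
have [w0 [/= ry _]] := (is_walk_cat v s0 [:: y]).1 w.
have eu : u = reflexion (walk v s0) y by rewrite -e walk_cat.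
have [r [wr er farr]] := geodesic (ex_intro2 _ _ s0 w0 erefl).
exfalso; apply: (@opp_simple_not_positive v y).
rewrite -eb eu reflexion_b_x opprK.
apply: (positivity adm wr er farr) => _; rewrite -eu => q wq eq.
apply: leq_trans (far q wq eq); rewrite size_cat addn1.
exact: leqW (farr _ w0 erefl).
Qed.

End Positivity.

(** * Independence of the pairing with coroots *)

Section CorootUniqueness.
Variables (K : numFieldType) (X : finType) (h : vectType K).
Implicit Types u v w : rootDatum X h.

Definition real_root v (beta : dual h) : Prop :=
  exists w z, Sk_set v w /\ beta = rd_b w z.

Definition coroot_at u x : h := (2 / cartan u x x) *: rd_a u x.

Lemma coroot_at_root u x : cartan u x x != 0 -> rd_b u x (coroot_at u x) = 2.
Proof. by move=> N; rewrite linearZ /= -/(cartan u x x) [LHS]divfK. Qed.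

Lemma linear_Vb_sum u w (psi : {linear dual h -> dual h}) gamma :
  (forall x, rd_b w x = psi (rd_b u x)) -> gamma \in Vb_space u ->
  psi gamma = \sum_x fcoord (rd_b u) x gamma *: rd_b w x.
Proof.
move=> e /fcoord_span {1}->; rewrite linear_sum; apply: eq_bigr => x _.
by rewrite linearZ e.
Qed.

(** As $r_xu$ has the Cartan datum of $u$, a walk from $u$ to the datum carrying [beta] can be
    repeated from $r_xu$, where it leads to the reflected roots. *)
Lemma real_root_reflect v u x beta : Sk_set v u -> reflectable u x ->
  cartan u x x != 0 -> real_root v beta ->
  real_root v (beta - beta (coroot_at u x) *: rd_b u x).
Proof.
move=> su rx N [w [z [sw ->]]].
have [s ws es] := Sk_trans (Sk_sym su) sw.
have e := same_cartan_D_equiv (same_cartan_anisotropic N).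
have [d [phi [psi [d0 t]]]] := D_equiv_twist e.
exists (walk (reflexion u x) s), z; split.
  apply: Sk_trans (Sk_trans su (Sk_reflexion rx)) _; exists s => //.
  exact: is_walk_translate e ws.
have [_ -> _ _] := twist_walk d0 s t; rewrite es.
have [_ tb _ _] := t.
have bw : rd_b w z \in Vb_space u by apply: rd_b_Vb; exists s.
rewrite (linear_Vb_sum tb bw) {1 2}(fcoord_span bw) sum_lfunE scaler_suml -sumrB.
apply: eq_bigr => y _; rewrite ffunE N scalerBr scale_lfunE !scalerA.
apply: (congr1 (fun k : K => _ - k *: _)).
rewrite /coroot_at linearZ /= -/(cartan u x y).
by congr (_ * _); rewrite [LHS]mulrAC.
Qed.

Lemma nat_progression (kz kx f : K) : kz != 0 ->
  (forall n : int, exists a b : nat, (kz = a%:R /\ kx - f *~ n = b%:R) \/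
     (kz = - a%:R /\ kx - f *~ n = - b%:R)) -> f = 0.
Proof.
move=> kz0 H.
wlog [a0 ea0] : kz kx f kz0 H / exists a : nat, kz = a%:R.
  move=> W; have [a [b [[ea _]|[ea _]]]] := H 0; first by apply: (W kz kx f) => //; exists a.
  apply/eqP; rewrite -oppr_eq0; apply/eqP; apply: (W (- kz) (- kx) (- f)).
  - by rewrite oppr_eq0.
  - move=> n; have [a' [b' H']] := H n; exists a', b'.
    rewrite mulNrz -opprD; case: H' => -[-> ->]; first by right.
    by left; rewrite !opprK.
  - by exists a; rewrite ea opprK.
have pos (n : int) : exists b : nat, kx - f *~ n = b%:R.
  have [a [b [[_ e]|[e _]]]] := H n; first by exists b.
  exfalso; move/negP: kz0; apply; move/eqP: e.
  by rewrite ea0 -subr_eq0 opprK -natrD pnatr_eq0 addn_eq0 => /andP[/eqP-> _].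
have [b0 e0] := pos 0; have [b1 e1] := pos 1.
rewrite mulr0z subr0 in e0.
have ef : f = (b0%:Z - b1%:Z)%:~R.
  by rewrite rmorphB /= -!pmulrn -e1 -e0 mulr1z; ring.
(* At this index the value is $b_0-\varphi^2(b_0+1)$, negative unless $\varphi=0$. *)
set phi := b0%:Z - b1%:Z in ef; have [b2 e2] := pos (phi * (b0%:Z + 1)).
have : (b0%:Z - phi * (phi * (b0%:Z + 1)))%:~R = b2%:Z%:~R :> K.
  by rewrite -[RHS]pmulrn -e2 e0 ef rmorphB /= -pmulrn [(phi * _)%:~R]intrM mulrzr.
move/intr_inj => e; have [p0|p0] := eqVneq phi 0; first by rewrite ef p0.
have : 1 <= phi * phi by nia.
by nia.
Qed.

Lemma lform_sub (g al : dual h) (k : K) (c : h) : (g - k *: al) c = g c - k * al c.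
Proof. by rewrite add_lfunE opp_lfunE scale_lfunE. Qed.

Lemma reflect_twice (g al : dual h) (c c' : h) : al c = 2 ->
  g - g c' *: al - (g - g c' *: al) c *: al = g - (g c - g c') *: al.
Proof.
move=> alc; have e (a b : K) : b + (a - b * 2) = a - b by ring.
by rewrite lform_sub alc -addrA -opprD -scalerDl e.
Qed.

(* For two candidate coroots [c], [c'] of [alpha] the product of the two
   reflections is a transvection along [alpha], which preserves real roots; by
   sign coherence a nontrivial one would make some coordinate of a real root
   change sign. *)
Lemma coroot_at_unique v u u' x x' beta : admissible v ->
  Sk_set v u -> reflectable u x -> cartan u x x != 0 ->
  Sk_set v u' -> reflectable u' x' -> cartan u' x' x' != 0 ->
  rd_b u x = rd_b u' x' -> real_root v beta ->
  beta (coroot_at u x) = beta (coroot_at u' x').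
Proof.
move=> adm su rx N su' rx' N' eb rb.
set al := rd_b u x; set c := coroot_at u x; set c' := coroot_at u' x'.
have alc : al c = 2 by exact: coroot_at_root.
have alc' : al c' = 2 by rewrite /al eb; exact: coroot_at_root.
set f := beta c - beta c'.
have step g : real_root v g -> real_root v (g - (g c - g c') *: al).
  move=> rg; have := real_root_reflect su' rx' N' rg; rewrite -eb -/c' -/al => rg'.
  by have := real_root_reflect su rx N rg'; rewrite -/c -/al reflect_twice.
have step' g : real_root v g -> real_root v (g - (g c' - g c) *: al).
  move=> rg; have := real_root_reflect su rx N rg; rewrite -/c -/al => rg'.
  by have := real_root_reflect su' rx' N' rg'; rewrite -eb -/c' -/al reflect_twice.
(* Both candidates take the value $2$ on [al], so the shift [f] stays constant and the transvection
   can be iterated, in both directions. *)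
have fal k : (beta - k *: al) c - (beta - k *: al) c' = f.
  by rewrite !lform_sub alc alc' /f opprB addrA subrK.
have fal' k : (beta - k *: al) c' - (beta - k *: al) c = - f by rewrite -(fal k) opprB.
have trans (n : int) : real_root v (beta - (f *~ n) *: al).
  case: n => n; last rewrite NegzE.
    elim: n => [|n IH]; first by rewrite mulr0z scale0r subr0.
    have := step _ IH; rewrite fal -addrA -opprD -scalerDl.
    by rewrite -addn1 PoszD mulrzDr mulr1z.
  elim: n => [|n IH].
    by have := step' _ rb; rewrite mulrNz mulr1z /f opprB.
  have := step' _ IH; rewrite fal' -addrA -opprD -scalerDl.
  have -> : - n.+2%:Z = - n.+1%:Z - 1 by lia.
  by rewrite [f *~ (_ - _)]mulrzDr mulrN1z.
have admu := admissible_Sk adm su.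
have bu : beta \in Vb_space u.
  have [w [z [sw ->]]] := rb; exact: rd_b_Vb (Sk_trans (Sk_sym su) sw).
apply/eqP; rewrite -subr_eq0 -/f; apply/eqP.
set k := fun z => fcoord (rd_b u) z beta.
have ek : beta = \sum_z k z *: rd_b u z by exact: fcoord_span.
(* A multiple of [al] pairs equally with both candidates. Otherwise some coordinate away from $x$ is
   nonzero; the transvections fix it, so it determines the sign. *)
have [[z [nzx kz]]|all0] := pselect (exists z, z != x /\ k z != 0); last first.
  have : beta = k x *: al.
    rewrite ek (bigD1 x) //= big1 ?addr0 // => z nzx.
    have [->|nz] := eqVneq (k z) 0; first by rewrite scale0r.
    by case: all0; exists z.
  by rewrite /f => ->; rewrite !scale_lfunE alc alc' subrr.
have coord (n : int) y : fcoord (rd_b u) y (beta - (f *~ n) *: al) = k y - (f *~ n) * (y == x)%:R.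
  by rewrite /fcoord linearB linearZ /= -!/(fcoord _ _ _) fcoord_free ?rd_b_free // eq_sym.
apply: (nat_progression (kx := k x) kz) => n.
have pcoord g y : positive u g -> exists a : nat, fcoord (rd_b u) y g = a%:R.
  case=> m ->; exists (m y); rewrite /fcoord linear_sum (bigD1 y) //= big1 => [|t nty].
    by rewrite linearMn /= -/(fcoord _ _ _) fcoord_free ?rd_b_free // eqxx addr0.
  by rewrite linearMn /= -/(fcoord _ _ _) fcoord_free ?rd_b_free // (negbTE nty) mul0rn.
have cz := coord n z; have cx := coord n x.
rewrite (negbTE nzx) mulr0 subr0 in cz; rewrite eqxx mulr1 in cx.
rewrite -cz -cx; have [w [t [sw ->]]] := trans n.
have [p|p] := sign_coherence t admu (Sk_trans (Sk_sym su) sw).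
  have [a ea] := pcoord _ z p; have [b eb'] := pcoord _ x p.
  by exists a, b; left.
have [a ea] := pcoord _ z p; have [b eb'] := pcoord _ x p.
exists a, b; right; rewrite -ea -eb' /fcoord !linearN /= !opprK //.
Qed.

End CorootUniqueness.

(** * The maps [sigma_b] on roots, parities and coroots *)

Section SigmaAction.
Variables (K : numFieldType) (X : finType) (h : vectType K).
Variable v : rootDatum X h.
Implicit Types u w : SkD v.

Lemma sigma_b_linear (w : Sk v) (psi : {linear dual h -> dual h}) (gamma : Vb v) :
  (forall x, rd_b w x = psi (rd_b v x)) -> vsval (sigma_b w gamma) = psi (vsval gamma).
Proof.
move=> e; rewrite (linear_Vb_sum e (subvsP gamma)).
exact: (sigma_linE gamma (SkP w)).
Qed.

Lemma sigma_b_one gamma : sigma_b (SkD_one v) gamma = gamma.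
Proof. by apply: subvs_inj; exact: (@sigma_b_linear _ idfun). Qed.

(** The linear map of the [twist] from $v$ to $u$ is the same at every stage of the two parallel
    walks. *)
Lemma sigma_b_walk u s x (gamma : Vb v) : is_walk v s ->
  vsval gamma = rd_b (walk v s) x -> vsval (sigma_b u gamma) = rd_b (walk u s) x.
Proof.
move=> ws e; have [d [phi [psi [d0 t]]]] := D_equiv_twist (SkDP u).
have [_ tb _ _] := t; rewrite (sigma_b_linear gamma tb) e.
by have [_ ->] := twist_walk d0 s t.
Qed.

Lemma sigma_b_mul u w gamma : sigma_b (SkD_mul u w) gamma = sigma_b u (sigma_b w gamma).
Proof.
apply: subvs_inj; have [s ws es] := SkP w.
have [d [phi [psi [d0 t]]]] := D_equiv_twist (SkDP u); have [_ tb _ _] := t.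
rewrite (sigma_b_linear _ tb) /= !sigma_linE; [|exact: SkP|exact: SkD_mul_Sk].
rewrite linear_sum; apply: eq_bigr => x _; rewrite linearZ /=; congr (_ *: _).
have [_ tb' _ _] := twist_walk d0 s t;
by rewrite (translateP (SkDP u) ws es) tb' es.
Qed.

Lemma sigma_b_morph : {morph (fun u => sigma_b u) : u1 u2 / (u1 * u2)%g}.
Proof.
by move=> u w; apply: val_inj; apply/lfunP => gamma; rewrite comp_lfunE; exact: sigma_b_mul.
Qed.

Lemma sigma_b_inj : admissible v -> injective (fun u => sigma_b u).
Proof.
move=> adm u w e; apply: SkD_eq.
have admw := admissible_Sk adm (SkP w).
apply: (Sk_eq_of_rd_b admw (Sk_trans (Sk_sym (SkP w)) (SkP u))).
by apply/ffunP => x; rewrite -!sigma_bE e.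
Qed.

Lemma sigma_b_Sigma_pr u gamma : Sp_set v u -> Sigma_pr v gamma ->
  Sigma_pr v (sigma_b u gamma).
Proof.
move=> spu [_ [x [[s ws <-] rx N e]]].
have D := walk_D_equiv s (SkDP u); have [_ [d [d0 A]]] := D.
exists (walk u s), x; split.
- by apply: Sp_trans spu _; exists s => //; exact: is_iso_walk_translate (SkDP u) ws.
- by have [] := @is_walk_translate _ _ _ _ _ [:: x] D (conj rx I).
- by rewrite A mulf_neq0.
- exact: sigma_b_walk (iso_walk ws) e.
Qed.

Lemma sigma_b_parity u gamma : Sigma_pr v gamma ->
  parity (sigma_b u gamma) = parity gamma.
Proof.
move=> [_ [x [[s ws <-] rx N e]]]; have w := iso_walk ws.
rewrite (parity_b (u := walk v s) _ e); last by exists s.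
rewrite (parity_b (u := walk u s) (x := x)).
- by have [-> _] := walk_D_equiv s (SkDP u).
- apply: Sk_trans (SkP u) _; exists s => //; exact: is_walk_translate (SkDP u) w.
- exact: sigma_b_walk.
Qed.

Lemma corootP gamma : Sigma_pr v gamma -> exists (w : rootDatum X h) x,
  [/\ Sp_set v w, reflectable w x, cartan w x x != 0, vsval gamma = rd_b w x &
      coroot gamma = coroot_at w x].
Proof.
move=> [w [x [sw rx N e]]].
rewrite /coroot; set C := (X in xget _ X).
have [w' [x' [sw' rx' N' e' ->]]] : C (xget 0 C).
  by apply: xgetPex; exists (coroot_at w x), w, x.
by exists w', x'.
Qed.

(** By [coroot_at_unique] the coroot chosen for the image of [alpha] may be replaced by the one at
    the end of the parallel walk from $u$. There the row of $x$ and $a_{xx}$ are both multiplied by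
    [d x], which cancels. *)
Lemma sigma_b_coroot u alpha beta : admissible v -> Sp_set v u ->
  Sigma_pr v alpha -> Sigma_pr v beta ->
  vsval (sigma_b u beta) (coroot (sigma_b u alpha)) = vsval beta (coroot alpha).
Proof.
move=> adm spu pa pb.
have [_ [x [[s ws <-] rx N e ->]]] := corootP pa.
have [w' [x' [sw' rx' N' e' ->]]] := corootP (sigma_b_Sigma_pr spu pa).
have [d [phi [psi [d0 t]]]] := D_equiv_twist (SkDP u).
have [_ tb _ _] := t; have [_ tb' _ tA] := twist_walk d0 s t.
have wu := is_walk_translate (SkDP u) (iso_walk ws).
have sw : Sk_set v (walk v s) by exists s => //; exact: iso_walk.
have swu : Sk_set v (walk u s) by apply: Sk_trans (SkP u) _; exists s.
have real_beta : real_root v (vsval (sigma_b u beta)).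
  have [w'' [z [/Sp_Sk sw'' _ _ ->]]] := sigma_b_Sigma_pr spu pb; by exists w'', z.
have D := walk_D_equiv s (SkDP u).
have Nu : cartan (walk u s) x x != 0 by rewrite tA mulf_neq0.
rewrite (@coroot_at_unique _ _ _ v w' (walk u s) x' x) //; first last.
- by rewrite -e' (sigma_b_walk u (iso_walk ws) e).
- by have [] := @is_walk_translate _ _ _ _ _ [:: x] D (conj rx I).
- exact: Sp_Sk.
have bs : vsval beta \in Vb_space (walk v s) by rewrite (Vb_space_Sk sw); exact: subvsP.
rewrite (sigma_b_linear _ tb) (linear_Vb_sum tb' bs) [in RHS](fcoord_span bs) !sum_lfunE.
apply: eq_bigr => y _; rewrite !scale_lfunE; congr (_ * _).
rewrite /coroot_at !linearZ /= -/(cartan (walk u s) x y) -/(cartan (walk v s) x y) !tA.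
rewrite /GRing.scale /=; field.
by rewrite N d0.
Qed.

End SigmaAction.

(** * Assembly of the linear and Dynkin diagram actions *)

Local Open Scope complex_scope.
Local Open Scope classical_set_scope.

Theorem theorem7p3 (R : realType) (X : finType) (h : vectType R[i])
    (v : rootDatum X h) (adm : admissible v) :
  [/\ {morph (fun u : SkD v => sigma_b u) : u1 u2 / (u1 * u2)%g},
      injective (fun u : SkD v => sigma_b u),
      forall u : SpD v,
        [set sigma_b u alpha | alpha in Sigma_pr v] = Sigma_pr v &
      exists res : SpD v -> Aut (Sigma_pr v),
        [/\ forall (u : SpD v) (alpha : Sigma_pr v),
              val (res u alpha) = sigma_b u (val alpha),
            {morph res : u1 u2 / (u1 * u2)%g} &
            forall u : SpD v, Dynkin v (res u)]].
Proof.
have sp (u : SpD v) : Sp_set v u by exact/asboolP/(SpDP u).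
have pres (u : SpD v) alpha := @sigma_b_Sigma_pr _ _ _ _ u alpha (sp u).
have mulE (u w : SpD v) alpha : sigma_b (u * w)%g alpha = sigma_b u (sigma_b w alpha).
  exact: sigma_b_mul.
have oneE alpha : sigma_b (1%g : SpD v) alpha = alpha by exact: sigma_b_one.
split.
- exact: sigma_b_morph.
- exact: sigma_b_inj.
- move=> u; apply/seteqP; split=> [_ [alpha pa <-]|alpha pa]; first exact: pres.
  (* The inverse of $u$ also lies in the spine, so this preimage is again a principal root. *)
  by exists (sigma_b u^-1%g alpha); rewrite -?mulE ?mulgV ?oneE //; exact: pres.
pose act (u : SpD v) (alpha : Sigma_pr v) : Sigma_pr v :=
  exist (fun y => y \in Sigma_pr v) (sigma_b u (val alpha)) (mem_set (pres u _ (set_valP alpha))).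
have actE u alpha : val (act u alpha) = sigma_b u (val alpha) by [].
have act_bij u : bijective (act u).
  exists (act u^-1%g) => alpha; apply: val_inj; rewrite !actE -mulE.
    by rewrite mulVg oneE.
  by rewrite mulgV oneE.
exists (fun u => MkAut (act_bij u)); split=> //.
- by move=> u w; apply: Aut_eq => alpha; apply: val_inj; rewrite [LHS]actE mulE.
- move=> u alpha beta /=; split; first exact: sigma_b_parity (set_valP alpha).
  by rewrite sigma_b_coroot //; exact: set_valP.
Qed.
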